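(* There is an absolute constant $C > 0$ such that the following holds. Consider a centered distribution in $\mathbb{R}^n$ with covariance matrix $\Sigma \neq 0$ and supported in some Euclidean ball centered at the origin whose radius is denoted $\sqrt{m}$. Let $\Sigma_N$ denote the sample covariance matrix formed from $N$ independent samples of the distribution. Let $\varepsilon \in (0,1)$ and $t \ge 1$. If $$N \ge C (t/\varepsilon)^2 \|\Sigma\|^{-1} m \log n,$$ then with probability at least $1 - n^{-t^2}$ one has $$\|\Sigma_N - \Sigma\| \le \varepsilon \|\Sigma\|.$$
   Context: For a centered random vector $X$ in $\mathbb{R}^n$ ($\mathbb{E}X=0$), the covariance matrix is $\Sigma = \mathbb{E}\,XX^T$. Given $N\ge 1$ independent samples $X_1,\dots,X_N$ from the distribution of $X$, the sample covariance matrix is $\Sigma_N = \frac1N \sum_{i=1}^N X_i X_i^T$. $\|\cdot\|$ applied to a matrix is the spectral (operator) norm. *)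

(* Defs.v *)
From mathcomp Require Import all_boot all_order all_algebra.
From mathcomp Require Import all_classical all_reals all_analysis.

Set Implicit Arguments.
Unset Strict Implicit.
Unset Printing Implicit Defensive.

Import Order.TTheory GRing.Theory Num.Theory.

Local Open Scope classical_set_scope.
Local Open Scope ring_scope.

(* Points of R^n are tuples in n.-tuple R, which carries the product
   sigma-algebra; colv turns them into column vectors. *)
Definition colv (R : realType) (n : nat) (x : n.-tuple R) : 'cV[R]_n :=
  \col_i tnth x i.

(* The library's norm on matrices is the max norm, hence the two
   definitions below. *)
Definition enorm (R : realType) (n : nat) (v : 'cV[R]_n) : R :=
  Num.sqrt (\sum_i v i 0 ^+ 2).

Definition spectral_norm (R : realType) (p n : nat) (A : 'M[R]_(p, n)) : R :=
  sup [set enorm (A *m v) | v in [set v : 'cV[R]_n | enorm v <= 1]].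

Definition centered (R : realType) (n : nat)
    (mu : probability (n.-tuple R) R) : Prop :=
  forall i : 'I_n, ('E_mu[fun x => tnth x i] = 0)%E.

Definition supported_in (d : measure_display) (T : measurableType d)
    (R : realType) (mu : probability T R) (A : set T) : Prop :=
  mu A = 1%E.

(* The covariance matrix E[x x^T] of a centered distribution.  Taking fine
   of the entries is harmless for a distribution with bounded support. *)
Definition covmx (R : realType) (n : nat)
    (mu : probability (n.-tuple R) R) : 'M[R]_n :=
  \matrix_(i, j) fine 'E_mu[fun x => (colv x *m (colv x)^T) i j].

Definition sample_covmx (R : realType) (n N : nat)
    (x : 'I_N -> n.-tuple R) : 'M[R]_n :=
  N%:R^-1 *: \sum_(i < N) colv (x i) *m (colv (x i))^T.

Definition mutually_independent (d d' : measure_display)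
    (T : measurableType d) (T' : measurableType d') (R : realType)
    (P : probability T R) (I : finType) (X : I -> {RV P >-> T'}) : Prop :=
  forall (J : {set I}) (B : I -> set T'),
    (forall i, measurable (B i)) ->
    P (\bigcap_(i in [set` J]) (X i @^-1` B i)) =
    (\prod_(i in J) P (X i @^-1` B i))%E.

Definition iid_sample (d d' : measure_display)
    (T : measurableType d) (T' : measurableType d') (R : realType)
    (P : probability T R) (mu : probability T' R) (N : nat)
    (X : 'I_N -> {RV P >-> T'}) : Prop :=
  mutually_independent X /\
  (forall (i : 'I_N) (B : set T'),
     measurable B -> distribution P (X i) B = mu B).

(* Main.v *)
Require Import Defs.
From mathcomp Require Import all_boot all_order all_algebra.
From mathcomp Require Import all_classical all_reals all_analysis.
From mathcomp Require Import measurable_realfun ring lra.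

Set Implicit Arguments.
Unset Strict Implicit.
Unset Printing Implicit Defensive.

Import Order.TTheory GRing.Theory Num.Theory.

Local Open Scope classical_set_scope.
Local Open Scope ring_scope.

(* Ahlswede-Winter argument with the exponential of a symmetric matrix A replaced
   by (1 + A/K)^K, where K is a large power of two.  For such K the inequality
   tr (UV)^K <= tr U^K V^K gives the Golden-Thompson inequality up to an error
   O(1/K), which is removed by choosing K last.  With Y_i = lam (X_i X_i^T - Sigma),
   independence and E (1 + Y_i/K)^K <= 1 + 2 E Y_i^2 bound the expected trace of
   (1 + (Y_1 + ... + Y_N)/K)^K, Markov's inequality bounds the upper tail of the
   quadratic form of the sum, and -lam takes care of the lower tail.  The variance
   is controlled by E (X X^T)^2 <= m Sigma; the vectors are truncated to the ball,
   which changes nothing almost surely. *)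

(** * Golden-Thompson for powers of two *)

(** The summands do not commute, so an exponential of their sum does not factor; a Golden-Thompson
    inequality is what lets one summand be split off at a time, under a trace. With a polynomial in
    place of the exponential everything stays algebraic: no eigenvalues, functional calculus or
    series are involved, and the trace is a polynomial in bounded entries, so independence is
    applied only to finite sums of products. Powers of two serve twice more: an even power of a
    symmetric matrix is a square, which gives positivity, and repeated squaring carries a lower
    bound on a quadratic form over to powers. Diagonalization is replaced by polarization and the
    Frobenius norm. The price lies in the constants: the exponent of the tail contains [theta / 2],
    because [1 + x] is compared with [expR (x / 2)], and the dimension appears as [2 * n], the
    second [n] absorbing the accumulated Golden-Thompson error. *)

Section Trace.
Variables (R : realType) (n : nat).
Implicit Types (M U V A B : 'M[R]_n).

Lemma mxtrace_mul_tr M : \tr (M * M^T) = \sum_i \sum_j M i j ^+ 2.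
Proof.
by apply: eq_bigr => i _; rewrite mxE; apply: eq_bigr => j _; rewrite mxE expr2.
Qed.

Lemma mxtrace_mul_tr_ge0 M : 0 <= \tr (M * M^T).
Proof. by rewrite mxtrace_mul_tr; do 2 apply: sumr_ge0 => ? _; exact: sqr_ge0. Qed.

Lemma mxtrace_AMGM A B :
  2 * \tr (A * B) <= \tr (A * A^T) + \tr (B^T * B).
Proof.
have := mxtrace_mul_tr_ge0 (A - B^T).
rewrite linearB /= trmxK mulrBl !mulrBr !raddfB /=.
have -> : \tr (B^T * A^T) = \tr (A * B) by rewrite -[RHS]mxtrace_tr trmx_mul.
lra.
Qed.

Lemma trmxX M k : (M ^+ k)^T = M^T ^+ k.
Proof.
elim: k => [|k IH]; first by rewrite !expr0 trmx1.
by rewrite exprS exprSr trmx_mul IH.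
Qed.

Lemma mxtrace_cyclicX A B k : \tr ((A * B) ^+ k) = \tr ((B * A) ^+ k).
Proof.
case: k => [//|k].
have -> : (A * B) ^+ k.+1 = A * ((B * A) ^+ k * B).
  elim: k => [|k IH]; first by rewrite expr0 expr1 mul1r.
  by rewrite exprS IH [in RHS]exprS !mulrA.
by rewrite -[A * _]/(A *m _) mxtrace_mulC exprSr !mulrA.
Qed.

(* Simultaneous induction: each inequality uses the other one at a lower exponent. *)
Lemma mxtrace_expr_pow2_le k :
  (forall M, \tr (M ^+ (2 ^ k.+1)) <= \tr ((M * M^T) ^+ (2 ^ k))) /\
  (forall U V, U^T = U -> V^T = V ->
     \tr ((U * V) ^+ (2 ^ k)) <= \tr (U ^+ (2 ^ k) * V ^+ (2 ^ k))).
Proof.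
elim: k => [|k [IHT IHG]].
  split=> [M|U V _ _]; last by rewrite expn0 !expr1.
  rewrite expn0 expn1 expr1 expr2; have := mxtrace_AMGM M M.
  have -> : \tr (M^T * M) = \tr (M * M^T) by rewrite mxtrace_mulC.
  lra.
(* The first inequality is applied to [M ^+ 2]; a cyclic shift then exposes the product of the
   symmetric matrices [M * M^T] and [M^T * M]. After the second inequality, AM-GM finishes, since
   powers of these two matrices have equal traces. *)
have T1 M : \tr (M ^+ (2 ^ k.+2)) <= \tr ((M * M^T) ^+ (2 ^ k.+1)).
  rewrite expnS exprM; apply: le_trans (IHT _) _.
  have -> : M ^+ 2 * (M ^+ 2)^T = M * (M * M^T * M^T).
    by rewrite trmxX !expr2 !mulrA.
  rewrite mxtrace_cyclicX.
  have -> : M * M^T * M^T * M = (M * M^T) * (M^T * M) by rewrite !mulrA.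
  have s1 : (M * M^T)^T = M * M^T by rewrite trmx_mul trmxK.
  have s2 : (M^T * M)^T = M^T * M by rewrite trmx_mul trmxK.
  apply: le_trans (IHG _ _ s1 s2) _.
  have := mxtrace_AMGM ((M * M^T) ^+ (2 ^ k)) ((M^T * M) ^+ (2 ^ k)).
  rewrite !trmxX s1 s2 -!exprD addnn -mul2n -expnS (mxtrace_cyclicX M^T).
  lra.
split=> // U V sU sV.
(* With M = UV, cyclicity turns (UVVU)^(2^k) into (U^2 V^2)^(2^k) under the trace, and the second
   inequality applies to the squares. *)
apply: le_trans (IHT _) _.
have -> : U * V * (U * V)^T = U * (V ^+ 2 * U).
  by rewrite trmx_mul sU sV expr2 -!mulrA.
rewrite mxtrace_cyclicX -mulrA -expr2 mxtrace_cyclicX.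
have := IHG (U ^+ 2) (V ^+ 2).
by rewrite !trmxX sU sV -!exprM -expnS; apply.
Qed.

Lemma mxtrace_golden_thompson k U V : U^T = U -> V^T = V ->
  \tr ((U * V) ^+ (2 ^ k)) <= \tr (U ^+ (2 ^ k) * V ^+ (2 ^ k)).
Proof. by move=> sU sV; apply: (mxtrace_expr_pow2_le k).2. Qed.

End Trace.

(** * Euclidean norm and operator bounds *)

Definition dotv (R : realType) n (u v : 'cV[R]_n) : R := \sum_i u i 0 * v i 0.

Section EuclideanNorm.
Variables (R : realType) (n : nat).
Implicit Types (u v w : 'cV[R]_n) (a : R) (M : 'M[R]_n).

Lemma dotvE u v : dotv u v = (u^T *m v) 0 0.
Proof. by rewrite mxE; apply: eq_bigr => i _; rewrite mxE. Qed.

Lemma dotvC u v : dotv u v = dotv v u.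
Proof. by apply: eq_bigr => i _; rewrite mulrC. Qed.

Lemma dotvDr u v w : dotv u (v + w) = dotv u v + dotv u w.
Proof. by rewrite !dotvE mulmxDr mxE. Qed.

Lemma dotvDl u v w : dotv (u + v) w = dotv u w + dotv v w.
Proof. by rewrite dotvC dotvDr !(dotvC w). Qed.

Lemma dotvZr a u v : dotv u (a *: v) = a * dotv u v.
Proof. by rewrite !dotvE -scalemxAr mxE. Qed.

Lemma dotvZl a u v : dotv (a *: u) v = a * dotv u v.
Proof. by rewrite dotvC dotvZr dotvC. Qed.

Lemma dotvNr u v : dotv u (- v) = - dotv u v.
Proof. by rewrite -scaleN1r dotvZr mulN1r. Qed.

Lemma dotvNl u v : dotv (- u) v = - dotv u v.
Proof. by rewrite dotvC dotvNr dotvC. Qed.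

Lemma dotv_mulmxl M u v : dotv (M *m u) v = dotv u (M^T *m v).
Proof. by rewrite !dotvE trmx_mul mulmxA. Qed.

Lemma dotv_ge0 v : 0 <= dotv v v.
Proof. by apply: sumr_ge0 => i _; rewrite -expr2 sqr_ge0. Qed.

Lemma dotv_eq0 v : dotv v v = 0 -> v = 0.
Proof.
move=> /eqP; rewrite psumr_eq0 => [/allP h|i _]; last by rewrite -expr2 sqr_ge0.
apply/matrixP => i j; rewrite ord1 mxE.
by have := h i (mem_index_enum i); rewrite /= mulf_eq0 orbb => /eqP.
Qed.

Lemma enorm_sqr v : enorm v ^+ 2 = dotv v v.
Proof.
rewrite sqr_sqrtr; last by apply: sumr_ge0 => i _; exact: sqr_ge0.
by apply: eq_bigr => i _; rewrite expr2.
Qed.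

Lemma enorm_ge0 v : 0 <= enorm v.
Proof. exact: sqrtr_ge0. Qed.

Lemma enorm_le v a : 0 <= a -> (enorm v <= a) = (dotv v v <= a ^+ 2).
Proof. by move=> a0; rewrite -enorm_sqr ler_pXn2r ?nnegrE ?enorm_ge0. Qed.

Lemma dotv_CauchySchwarz u v : dotv u v ^+ 2 <= dotv u u * dotv v v.
Proof.
have [v0|v0] := eqVneq (dotv v v) 0.
  rewrite (dotv_eq0 v0) -(scale0r 0) !dotvZr !mul0r mulr0 expr0n //=.
have vp : 0 < dotv v v by rewrite lt_neqAle eq_sym v0 dotv_ge0.
(* This squared norm is [dotv v v] times the gap in the claim. *)
have := dotv_ge0 (dotv v v *: u - dotv u v *: v).
rewrite !(dotvDl, dotvDr, dotvNl, dotvNr, dotvZl, dotvZr) (dotvC v u) => h.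
rewrite -subr_ge0 -(pmulr_rge0 _ vp).
apply: le_trans h _; rewrite le_eqVlt; apply/orP; left; apply/eqP; ring.
Qed.

Lemma dotv_le_enorm u v : `|dotv u v| <= enorm u * enorm v.
Proof.
rewrite -(ler_pXn2r (_ : 0 < 2)%N) ?nnegrE ?mulr_ge0 ?enorm_ge0 //.
by rewrite real_normK ?num_real // exprMn !enorm_sqr dotv_CauchySchwarz.
Qed.

Lemma enormD u v : enorm (u + v) <= enorm u + enorm v.
Proof.
rewrite enorm_le ?addr_ge0 ?enorm_ge0 // !(dotvDl, dotvDr) (dotvC v u) sqrrD.
rewrite !enorm_sqr; have := le_trans (ler_norm _) (dotv_le_enorm u v); lra.
Qed.

Lemma enormZ a v : enorm (a *: v) = `|a| * enorm v.
Proof.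
apply/eqP; rewrite -(eqrXn2 (_ : 0 < 2)%N) ?mulr_ge0 ?enorm_ge0 //.
by rewrite exprMn !enorm_sqr dotvZl dotvZr real_normK ?num_real // mulrA expr2.
Qed.

Lemma enorm0 : enorm (0 : 'cV[R]_n) = 0.
Proof. by rewrite -(scale0r 0) enormZ normr0 mul0r. Qed.

Lemma enorm_eq0 v : enorm v = 0 -> v = 0.
Proof. by move=> h; apply: dotv_eq0; rewrite -enorm_sqr h expr0n. Qed.

Lemma enorm_delta (i : 'I_n) : enorm (delta_mx i 0 : 'cV[R]_n) = 1.
Proof.
apply/eqP; rewrite -(eqrXn2 (_ : 0 < 2)%N) ?enorm_ge0 // enorm_sqr /dotv.
rewrite (bigD1 i) //= big1 => [|j ji].
  by rewrite !mxE !eqxx mulr1 addr0 expr1n.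
by rewrite !mxE (negbTE ji) mul0r.
Qed.

Lemma dotv_delta (i : 'I_n) v : dotv (delta_mx i 0) v = v i 0.
Proof.
rewrite /dotv (bigD1 i) //= big1 => [|j ji].
  by rewrite !mxE !eqxx mul1r addr0.
by rewrite !mxE (negbTE ji) mul0r.
Qed.

Lemma entry_le_enorm v i : `|v i 0| <= enorm v.
Proof. by rewrite -dotv_delta (le_trans (dotv_le_enorm _ _)) // enorm_delta mul1r. Qed.

End EuclideanNorm.

(** A bound on the operator norm stated without a supremum, so that bounds add and multiply
    directly; [spectral_norm] is connected to it only near the end. *)
Definition opb (R : realType) n (M : 'M[R]_n) (b : R) : Prop :=
  forall v, enorm (M *m v) <= b * enorm v.

Section OperatorBound.
Variables (R : realType) (n : nat).
Implicit Types (u v : 'cV[R]_n) (a b : R) (A B M P Q Y : 'M[R]_n).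

Lemma opbW M a b : a <= b -> opb M a -> opb M b.
Proof. by move=> ab h v; rewrite (le_trans (h v)) // ler_wpM2r ?enorm_ge0. Qed.

Lemma opbD A B a b : opb A a -> opb B b -> opb (A + B) (a + b).
Proof.
move=> hA hB v; rewrite mulmxDl mulrDl (le_trans (enormD _ _)) //.
exact: lerD.
Qed.

Lemma opbZ M a b : opb M b -> opb (a *: M) (`|a| * b).
Proof. by move=> h v; rewrite -scalemxAl enormZ -mulrA ler_wpM2l. Qed.

Lemma opb1 : opb (1 : 'M[R]_n) 1.
Proof. by move=> v; rewrite mul1mx mul1r. Qed.

Lemma opb0 : opb (0 : 'M[R]_n) 0.
Proof. by move=> v; rewrite mul0mx mul0r enorm0. Qed.

Lemma opbM A B a b : 0 <= a -> opb A a -> opb B b -> opb (A * B) (a * b).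
Proof.
move=> a0 hA hB v; rewrite -mulmxA (le_trans (hA _)) // -mulrA.
exact: ler_wpM2l.
Qed.

Lemma opbX M b j : 0 <= b -> opb M b -> opb (M ^+ j) (b ^+ j).
Proof.
move=> b0 h; elim: j => [|j IH]; first exact: opb1.
by rewrite !exprS; apply: opbM.
Qed.

Lemma opb_mxtrace M b : opb M b -> `|\tr M| <= n%:R * b.
Proof.
move=> h; rewrite (le_trans (ler_norm_sum _ _ _)) //.
rewrite (@le_trans _ _ (\sum_(i < n) b)) //; last by rewrite sumr_const card_ord mulr_natl.
apply: ler_sum => i _.
have -> : M i i = (M *m delta_mx i 0 : 'cV_n) i 0.
  rewrite mxE (bigD1 i) //= big1 => [|j ji]; first by rewrite mxE !eqxx mulr1 addr0.
  by rewrite mxE (negbTE ji) mulr0.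
by rewrite (le_trans (entry_le_enorm _ _)) // (le_trans (h _)) // enorm_delta mulr1.
Qed.

(** Telescoping: each of the j factors is exchanged at the cost of c, the others contributing at
    most b each. The surplus factor b is harmless since b is at least 1. *)
Lemma opb_subX P Q b c j : 1 <= b -> 0 <= c -> opb P b -> opb Q b ->
  opb (Q - P) c -> opb (Q ^+ j - P ^+ j) (j%:R * b ^+ j * c).
Proof.
move=> b1 c0 hP hQ hQP; have b0 : 0 <= b by lra.
elim: j => [|j IH]; first by rewrite subrr !mul0r; exact: opb0.
have -> : Q ^+ j.+1 - P ^+ j.+1 = Q ^+ j * (Q - P) + (Q ^+ j - P ^+ j) * P.
  by rewrite mulrBr mulrBl !exprSr addrA subrK.
apply: (opbW _ (opbD (opbM _ (opbX j b0 hQ) hQP) (opbM _ IH hP))).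
- rewrite -natr1 exprSr !mulrDl mul1r addrC.
  have : b ^+ j * c <= b ^+ j * b * c.
    by rewrite ler_wpM2r // ler_peMr // exprn_ge0.
  lra.
- exact: exprn_ge0.
- by rewrite !mulr_ge0 // exprn_ge0.
Qed.

(** Replaces the fact that the norm of a symmetric matrix is its largest eigenvalue in absolute
    value. *)
Lemma opb_polarization M b : 0 <= b -> M^T = M ->
  (forall v, `|dotv v (M *m v)| <= b * dotv v v) -> opb M b.
Proof.
move=> b0 sM h v.
(* The forms at u + v and u - v differ by four times the mixed term, and the parallelogram law adds
   up their bounds. *)
have pol u : 2 * dotv u (M *m v) <= b * (dotv u u + dotv v v).
  have := le_trans (ler_norm _) (h (u + v)).
  have := h (u - v); rewrite ler_norml => /andP[+ _].
  have e : dotv v (M *m u) = dotv u (M *m v) by rewrite -{1}sM -dotv_mulmxl dotvC.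
  rewrite !(mulmxDr, mulmxN, dotvDl, dotvDr, dotvNl, dotvNr) (dotvC v u) e.
  lra.
have [b00|bp] : b = 0 \/ 0 < b.
  by move: b0; rewrite le_eqVlt => /predU1P[<-|]; [left|right].
- have := pol (M *m v); rewrite b00 !mul0r => h0.
  rewrite enorm_le // expr0n /=; lra.
- rewrite enorm_le ?mulr_ge0 ?enorm_ge0 // exprMn enorm_sqr.
  (* The scaling by 1/b balances the two sides: what remains is |Mv|^2 at most b^2 |v|^2. *)
  have := pol (b^-1 *: (M *m v)); rewrite !(dotvZl, dotvZr).
  set x := dotv (M *m v) _; set y := dotv v v => hp.
  have : b * (2 * (b^-1 * x)) <= b * (b * (b^-1 * (b^-1 * x) + y)).
    by rewrite ler_pM2l.
  have -> : b * (2 * (b^-1 * x)) = 2 * x by field; rewrite gt_eqF.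
  have -> : b * (b * (b^-1 * (b^-1 * x) + y)) = x + b ^+ 2 * y.
    by field; rewrite gt_eqF.
  lra.
Qed.

End OperatorBound.

(** * Polynomial exponentials *)

Definition pexp (R : realType) n k (A : 'M[R]_n) : 'M[R]_n :=
  (1 + (2 ^ k)%:R^-1 *: A) ^+ (2 ^ k).

Section PolynomialExponential.
Variables (R : realType) (n : nat).
Implicit Types (u v : 'cV[R]_n) (a b : R) (A B M P Q S Y : 'M[R]_n).

(* For square matrices of arbitrary size, scalerAl and scalerAr are not
   available since these only form a ring that may be trivial. *)
Lemma scalesqmxAl x A B : x *: (A * B) = x *: A * B.
Proof. exact: scalemxAl. Qed.

Lemma scalesqmxAr x A B : x *: (A * B) = A * (x *: B).
Proof. exact: scalemxAr. Qed.

Lemma trmx_1DZ x A : A^T = A -> (1 + x *: A)^T = 1 + x *: A.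
Proof. by move=> sA; rewrite linearD /= linearZ /= trmx1 sA. Qed.

Lemma ler_1D_expR x j : 0 <= x -> (1 + x) ^+ j <= expR (x * j%:R) :> R.
Proof.
by move=> x0; rewrite expRM_natr lerXn2r ?nnegrE ?expR_ge0 ?expR_ge1Dx ?addr_ge0.
Qed.

(** On the unit interval, exp(x/2) is at most 1/(1 - x/2), which is at most 1 + x. This is where the
    exponent of the tail bound loses a factor 2. *)
Lemma ler_expR_half x j : 0 <= x -> x <= 1 -> expR (x * j%:R / 2) <= (1 + x) ^+ j :> R.
Proof.
move=> x0 x1; have -> : x * j%:R / 2 = x / 2 * j%:R by ring.
rewrite expRM_natr lerXn2r ?nnegrE ?expR_ge0 ?addr_ge0 //.
have p : 0 < 1 + x by lra.
rewrite -[x / 2]opprK expRN -[leRHS]invrK lef_pV2 ?posrE ?expR_gt0 ?invr_gt0 //.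
apply: le_trans (expR_ge1Dx _).
rewrite -[leLHS]mul1r ler_pdivrMr //; nra.
Qed.

(** A crude bound is enough: it produces the coefficient 2 = 4 - 2 of the quadratic term in
    [pexp_quadratic_le]. *)
Lemma expR1_le4 : expR 1 <= 4 :> R.
Proof.
have -> : 1 = 2^-1 * 2%:R :> R by field.
rewrite expRM_natr.
have h : expR 2^-1 <= 2 :> R.
  rewrite -[2^-1]opprK expRN -[leRHS]invrK lef_pV2 ?posrE ?expR_gt0 ?invr_gt0 //.
  by apply: le_trans (expR_ge1Dx _); lra.
have := expR_ge0 (2^-1 : R); rewrite expr2; nra.
Qed.

(** The product (1 + A/K)(1 + Y/K) differs from 1 + (A + Y)/K only by AY/K^2. Over K factors this
    accumulates to O(1/K), and the K-th power of the product falls under the Golden-Thompson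
    inequality for powers. *)
Lemma mxtrace_pexpD k A Y a : A^T = A -> Y^T = Y -> 0 <= a -> opb A a -> opb Y 1 ->
  \tr (pexp k (A + Y)) <=
  \tr (pexp k A * pexp k Y) + n%:R * (a * expR (2 * a + 1)) / (2 ^ k)%:R.
Proof.
move=> sA sY a0 hA hY; rewrite /pexp.
have K1 : 1 <= (2 ^ k)%:R :> R by rewrite ler1n expn_gt0.
set K := (2 ^ k)%:R : R in K1 *; set j := (2 ^ k)%N.
have K0 : 0 < K by lra.
have V1 : K^-1 <= 1 by rewrite invf_le1.
have V0 : 0 < K^-1 by rewrite invr_gt0.
apply: (@le_trans _ _ (\tr (((1 + K^-1 *: A) * (1 + K^-1 *: Y)) ^+ j) +
   n%:R * (a * expR (2 * a + 1)) / K)); last first.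
  rewrite lerD2r; apply: mxtrace_golden_thompson; exact: trmx_1DZ.
set P := 1 + K^-1 *: (A + Y); set Q := _ * _.
have QP : Q = P + K^-1 ^+ 2 *: (A * Y).
  rewrite /Q /P mulrDl mul1r mulrDr mulr1 -scalesqmxAl -scalesqmxAr scalerA -expr2.
  by rewrite scalerDr !addrA (addrAC _ (K^-1 *: Y)).
have hAY : opb (K^-1 ^+ 2 *: (A * Y)) (K^-1 ^+ 2 * a).
  rewrite -[X in X * a]ger0_norm; last by rewrite exprn_ge0 // ltW.
  by rewrite -[a]mulr1; apply/opbZ/opbM.
have hP : opb P (1 + K^-1 * (a + 1)).
  apply: opbD; first exact: opb1.
  by rewrite -[X in X * (a + 1)]ger0_norm ?(ltW V0) //; apply/opbZ/opbD.
(* A common bound for P and Q: the second a absorbs AY/K^2, and b^K is at most exp(2a + 1) whatever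
   K is. *)
pose b := 1 + K^-1 * (2 * a + 1).
have hP' : opb P b by apply: opbW hP; rewrite /b; nra.
have hQ' : opb Q b.
  rewrite QP; apply: opbW (opbD hP hAY); rewrite /b expr2 -mulrA.
  have : K^-1 * (K^-1 * a) <= K^-1 * a by rewrite ler_pM2l // ler_piMl.
  nra.
have hd : opb (Q - P) (K^-1 ^+ 2 * a) by rewrite QP addrC addKr.
have b1 : 1 <= b by rewrite /b; nra.
have c0 : 0 <= K^-1 ^+ 2 * a by rewrite mulr_ge0 // exprn_ge0 // ltW.
have := opb_mxtrace (opb_subX j b1 c0 hP' hQ' hd).
rewrite raddfB /= ler_norml => /andP[+ _].
have -> : n%:R * (j%:R * b ^+ j * (K^-1 ^+ 2 * a)) = n%:R * (a * b ^+ j) / K.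
  rewrite -[j%:R]/K; field; rewrite gt_eqF //.
have : n%:R * (a * b ^+ j) / K <= n%:R * (a * expR (2 * a + 1)) / K.
  rewrite ler_wpM2r ?(ltW V0) // ler_wpM2l // ler_wpM2l //.
  rewrite /b (le_trans (ler_1D_expR _ _)) //; first by rewrite mulr_ge0 // ?ltW //; lra.
  by rewrite -[j%:R]/K mulrAC mulVf ?mul1r // gt_eqF.
lra.
Qed.

(* Second-order expansion with remainder Y q Y; the bound on q is the value of
   the same remainder at Y = 1. *)
Lemma expr_1DZ_quadratic x Y j : 0 <= x -> opb Y 1 -> exists q : 'M[R]_n,
  (1 + x *: Y) ^+ j = 1 + (j%:R * x) *: Y + Y * q * Y /\
  opb q ((1 + x) ^+ j - 1 - j%:R * x).
Proof.
move=> x0 hY; elim: j => [|j [q [E hq]]].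
  exists 0; rewrite !expr0 mul0r scale0r mulr0 mul0r !addr0; split=> //.
  by rewrite subrr subr0; exact: opb0.
(* Multiplying the expansion by one more factor 1 + xY creates the new term j x^2 Y^2, while the old
   remainder lets 1 + xY move inside because it commutes with Y. *)
exists (((j%:R * x ^+ 2) *: (1 : 'M[R]_n) : 'M[R]_n) + (q * (1 + x *: Y) : 'M[R]_n)); split.
  rewrite exprSr E mulrDr mulr1 -scalesqmxAr -addrA -addrA.
  rewrite !(mulrDl, mulrDr, mulr1, mul1r, scalerDr).
  rewrite -!(scalesqmxAl, scalesqmxAr) !scalerA mulr1 -natr1 mulrDl mul1r scalerDl.
  have -> : x * (j%:R * x) = j%:R * x ^+ 2 by ring.
  rewrite !mulrA -!addrA; congr (_ + (_ + _)).
  by rewrite [LHS]addrCA; congr (_ + _); rewrite [LHS]addrCA.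
have x1 : 0 <= 1 + x by lra.
have h1 : opb (1 + x *: Y) (1 + x).
  apply: opbD; first exact: opb1.
  by rewrite -[X in opb _ X]mulr1 -[X in X * 1](ger0_norm x0); exact: opbZ.
have r0 : 0 <= (1 + x) ^+ j - 1 - j%:R * x.
  elim: (j) => [|i IH]; first by rewrite expr0; lra.
  have := exprn_ge0 i x1.
  have : 0 <= i%:R :> R by []. rewrite exprS -natr1; nra.
have hA := opbZ (j%:R * x ^+ 2) (@opb1 R n).
apply: opbW (opbD hA (opbM r0 hq h1)).
rewrite mulr1 ger0_norm ?mulr_ge0 ?exprn_ge0 // [(1 + x) ^+ j.+1]exprSr -natr1.
by rewrite le_eqVlt; apply/orP; left; apply/eqP; ring.
Qed.

(** The remainder at Y = 1 is (1 + 1/K)^K - 2, at most e - 2 and hence at most 2, uniformly in K. *)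
Lemma pexp_quadratic_le k Y v : Y^T = Y -> opb Y 1 ->
  dotv v (pexp k Y *m v) <=
  dotv v v + dotv v (Y *m v) + 2 * dotv (Y *m v) (Y *m v).
Proof.
move=> sY hY; rewrite /pexp; set K := (2 ^ k)%:R : R.
have K1 : 1 <= K by rewrite ler1n expn_gt0.
have K0 : K^-1 * K = 1 by rewrite mulVf // gt_eqF //; lra.
have V0 : 0 <= K^-1 by rewrite invr_ge0; lra.
have [q [-> hq]] := expr_1DZ_quadratic (2 ^ k) V0 hY.
rewrite -/K mulfV ?scale1r; last by rewrite gt_eqF //; lra.
rewrite !mulmxDl mul1mx !dotvDr lerD2l -!mulmxA -{1}sY -dotv_mulmxl.
set w := Y *m v; rewrite (le_trans (ler_norm _)) // (le_trans (dotv_le_enorm _ _)) //.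
have := hq w; rewrite -/K -enorm_sqr.
have : (1 + K^-1) ^+ (2 ^ k) <= 4.
  by apply: le_trans (ler_1D_expR _ V0) _; rewrite -/K K0 expR1_le4.
rewrite [K * _]mulrC K0.
set e := enorm w; set f := enorm _; have : 0 <= e by exact: enorm_ge0.
have : 0 <= f by exact: enorm_ge0.
move=> *; nra.
Qed.

(** Jensen's inequality for the spectral measure of B at v, obtained by repeated squaring: with C =
    B^(2^k) and c = a^(2^k), expanding |Cv - cv|^2 >= 0 bounds the form of C^2 from below by c^2
    |v|^2. *)
Lemma mulmx_exp_pow2_ge B a v k : B^T = B -> 0 <= a ->
  a * dotv v v <= dotv v (B *m v) ->
  a ^+ (2 ^ k) * dotv v v <= dotv v (B ^+ (2 ^ k) *m v).
Proof.
move=> sB a0 h; elim: k => [|k IH]; first by rewrite expn0 !expr1.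
have sC : (B ^+ (2 ^ k))^T = B ^+ (2 ^ k) by rewrite trmxX sB.
rewrite expnSr !exprM [X in X *m v]expr2 -mulmxA -{1}sC -dotv_mulmxl.
set C := B ^+ _ in sC IH *; set c := a ^+ _ in IH *.
have := dotv_ge0 (C *m v - c *: v).
have c0 : 0 <= c by exact: exprn_ge0.
rewrite !(dotvDl, dotvDr, dotvNl, dotvNr, dotvZl, dotvZr) (dotvC (C *m v) v) expr2.
nra.
Qed.

Lemma dotv_mulmx_le_frobenius M v :
  dotv (M *m v) (M *m v) <= \tr (M * M^T) * dotv v v.
Proof.
rewrite mxtrace_mul_tr mulr_suml; apply: ler_sum => i _.
rewrite -expr2 mxE.
have := dotv_CauchySchwarz (\col_j M i j) v; rewrite /dotv.
under eq_bigr do rewrite mxE.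
by under [X in _ <= X * _ -> _]eq_bigr do rewrite mxE -expr2.
Qed.

Lemma opb_frobenius M : opb M (Num.sqrt (\tr (M * M^T))).
Proof.
move=> v; rewrite enorm_le ?mulr_ge0 ?sqrtr_ge0 ?enorm_ge0 //.
by rewrite exprMn enorm_sqr sqr_sqrtr ?mxtrace_mul_tr_ge0 // dotv_mulmx_le_frobenius.
Qed.

Lemma mxtrace_sqr_ge H v : H^T = H ->
  dotv v (H ^+ 2 *m v) <= \tr (H ^+ 2) * dotv v v.
Proof.
move=> sH; rewrite expr2 -mulmxA -{1}sH -dotv_mulmxl.
by rewrite -[X in \tr (_ * X)]sH dotv_mulmx_le_frobenius.
Qed.

(** Exponents [k.+1] are used from here on so that the polynomial exponential of a symmetric matrix
    is the square of a symmetric one; its trace is then nonnegative and dominates its quadratic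
    form. *)
Lemma pexp_sqr k A : pexp k.+1 A = ((1 + (2 ^ k.+1)%:R^-1 *: A) ^+ (2 ^ k)) ^+ 2.
Proof. by rewrite /pexp expnSr exprM. Qed.

Lemma mxtrace_pexp_ge0 k A : A^T = A -> 0 <= \tr (pexp k.+1 A).
Proof.
move=> sA; rewrite pexp_sqr expr2; set H := _ ^+ _.
have {2}<- : H^T = H by rewrite trmxX trmx_1DZ.
exact: mxtrace_mul_tr_ge0.
Qed.

(** Stands in for tr exp(S) >= exp(largest eigenvalue): one direction with a large form makes the
    trace large. *)
Lemma mxtrace_pexp_ge k S a v : S^T = S -> 0 <= a -> v != 0 ->
  a * dotv v v <= dotv v (S *m v) ->
  (1 + a / (2 ^ k.+1)%:R) ^+ (2 ^ k.+1) <= \tr (pexp k.+1 S).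
Proof.
move=> sS a0 v0 h.
have vp : 0 < dotv v v.
  by rewrite lt_neqAle dotv_ge0 andbT eq_sym; apply: contra_neq v0; exact: dotv_eq0.
set K := (2 ^ k.+1)%:R : R; have K0 : 0 <= K^-1 by rewrite invr_ge0.
rewrite -(ler_pM2r vp).
have sH := trmx_1DZ K^-1 sS.
apply: le_trans (mulmx_exp_pow2_ge k.+1 sH _ _) _.
- by rewrite addr_ge0 // mulr_ge0.
- rewrite mulmxDl mul1mx -scalemxAl dotvDr dotvZr mulrDl mul1r lerD2l.
  by rewrite mulrAC mulrC ler_wpM2l.
- rewrite pexp_sqr -/K expnSr exprM; apply: mxtrace_sqr_ge.
  by rewrite trmxX sH.
Qed.

End PolynomialExponential.

(** * Bounded measurable functions *)

(** An algebra of functions, all integrable for every probability measure, so that linearity of the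
    mean carries no further side conditions. *)
Definition bmf (d : measure_display) (T : measurableType d) (R : realType)
  (f : T -> R) : Prop :=
  measurable_fun setT f /\ exists M, forall x, `|f x| <= M.

Definition mean (d : measure_display) (T : measurableType d) (R : realType)
  (P : probability T R) (f : T -> R) : R := \int[P]_x f x.

Section BoundedMeasurable.
Context (d : measure_display) (T : measurableType d) (R : realType).
Implicit Types (f g : T -> R).

Lemma bmf_cst (c : R) : bmf (fun _ : T => c).
Proof. by split; [exact: measurable_cst | exists `|c|]. Qed.

Lemma bmfD f g : bmf f -> bmf g -> bmf (fun x => f x + g x).
Proof.
move=> [mf [a ha]] [mg [b hb]]; split; first exact: measurable_funD.
by exists (a + b) => x; rewrite (le_trans (ler_normD _ _)) // lerD.
Qed.

Lemma bmfM f g : bmf f -> bmf g -> bmf (fun x => f x * g x).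
Proof.
move=> [mf [a ha]] [mg [b hb]]; split; first exact: measurable_funM.
by exists (a * b) => x; rewrite normrM ler_pM.
Qed.

Lemma bmfZ c f : bmf f -> bmf (fun x => c * f x).
Proof. exact/bmfM/bmf_cst. Qed.

Lemma bmf_sum (I : Type) (r : seq I) (F : I -> T -> R) :
  (forall i, bmf (F i)) -> bmf (fun x => \sum_(i <- r) F i x).
Proof.
move=> h; elim: r => [|i r IH].
  by under eq_fun do rewrite big_nil; exact: bmf_cst.
by under eq_fun do rewrite big_cons; exact: bmfD.
Qed.

Lemma bmf_prod (I : Type) (r : seq I) (p : pred I) (F : I -> T -> R) :
  (forall i, bmf (F i)) -> bmf (fun x => \prod_(i <- r | p i) F i x).
Proof.
move=> h; elim: r => [|i r IH].
  by under eq_fun do rewrite big_nil; exact: bmf_cst.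
under eq_fun do rewrite big_cons.
by case: (p i) => //; exact: bmfM.
Qed.

Lemma bmf_indic (A : set T) : measurable A -> bmf (\1_A : T -> R).
Proof.
move=> mA; split; first exact: measurable_indic.
by exists 1 => x; rewrite indicE; case: (x \in A); rewrite ?normr1 ?normr0.
Qed.

Lemma bmf_comp (d' : measure_display) (T' : measurableType d') (X : T' -> T) f :
  measurable_fun setT X -> bmf f -> bmf (fun x => f (X x)).
Proof.
move=> mX [mf [a ha]]; split; first exact: (measurableT_comp mf mX).
by exists a => x.
Qed.

Variable P : probability T R.

Lemma bmf_integrable f : bmf f -> P.-integrable setT (EFin \o f).
Proof.
move=> [mf [a ha]]; apply: (@measurable_bounded_integrable _ _ _ P) => //.
  exact: le_lt_trans (probability_le1 P measurableT) (ltry _).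
exists a; split; first exact: num_real.
by move=> M aM x _ /=; rewrite (le_trans (ha x)) // ltW.
Qed.

Lemma mean_cst c : mean P (fun _ => c) = c.
Proof. 
rewrite /mean Rintegral_cst //.
by rewrite [X in fine X](@probability_setT _ T R P) mulr1.
 Qed.

Lemma meanD f g : bmf f -> bmf g -> mean P (fun x => f x + g x) = mean P f + mean P g.
Proof. by move=> hf hg; apply: RintegralD => //; exact: bmf_integrable. Qed.

Lemma meanZ c f : bmf f -> mean P (fun x => c * f x) = c * mean P f.
Proof. by move=> hf; apply: RintegralZl => //; exact: bmf_integrable. Qed.

Lemma mean_sum (I : Type) (r : seq I) (F : I -> T -> R) :
  (forall i, bmf (F i)) ->
  mean P (fun x => \sum_(i <- r) F i x) = \sum_(i <- r) mean P (F i).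
Proof.
move=> h; elim: r => [|i r IH].
  by under eq_fun do rewrite big_nil; rewrite big_nil mean_cst.
under eq_fun do rewrite big_cons.
by rewrite big_cons meanD ?IH //; exact: bmf_sum.
Qed.

Lemma ler_mean f g : bmf f -> bmf g -> (forall x, f x <= g x) -> mean P f <= mean P g.
Proof. by move=> hf hg h; apply: le_Rintegral => //; exact: bmf_integrable. Qed.

Lemma normr_mean_le f M : bmf f -> (forall x, `|f x| <= M) -> `|mean P f| <= M.
Proof.
move=> hf h; rewrite ler_norml; apply/andP; split.
  rewrite -[- M]mean_cst; apply: ler_mean => //; first exact: bmf_cst.
  by move=> x; have := h x; rewrite ler_norml => /andP[].
rewrite -[leRHS]mean_cst; apply: ler_mean => //; first exact: bmf_cst.
by move=> x; have := h x; rewrite ler_norml => /andP[].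
Qed.

Lemma mean_indic (A : set T) : measurable A -> mean P (\1_A) = fine (P A).
Proof. by move=> mA; rewrite /mean /Rintegral integral_indic // setIT. Qed.

Lemma markov_mean f (c : R) : bmf f -> (forall x, 0 <= f x) -> 0 < c ->
  c * fine (P [set x | c <= f x]) <= mean P f.
Proof.
move=> hf f0 c0.
have mA : measurable [set x | c <= f x].
  by rewrite -[X in measurable X]setTI; apply: measurable_fun_le => //; case: hf.
rewrite -mean_indic // -meanZ; last exact: bmf_indic.
apply: ler_mean => //; first exact/bmfZ/bmf_indic.
move=> x; rewrite indicE; case: (boolP (x \in _)) => [|_]; last by rewrite mulr0.
by rewrite inE mulr1.
Qed.

End BoundedMeasurable.

(** * Uniform approximation by simple functions *)

Section Approximation.
Context (d : measure_display) (T : measurableType d) (R : realType).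
Implicit Types (f g : T -> R).

(** The sum counts the positive integers up to g, so it is the integer part of g. *)
Lemma layer_cake_bound (g : R) m : 0 <= g -> g <= m%:R ->
  `|g - \sum_(k < m) (k.+1%:R <= g)%R%:R| <= 1.
Proof.
move=> g0; elim: m => [|m IH] gm.
  by rewrite big_ord0 subr0 ger0_norm // (le_trans gm).
have [gm'|gm'] := leP g m%:R.
  rewrite big_ord_recr /=; have [h|_] := leP (m.+1%:R) g; last first.
    by rewrite addr0; exact: IH.
  by move: (le_trans h gm'); rewrite ler_nat ltnn.
have -> : \sum_(k < m.+1) (k.+1%:R <= g)%R%:R = m%:R + (m.+1%:R <= g)%R%:R :> R.
  rewrite big_ord_recr /=; congr (_ + _).
  rewrite (eq_bigr (fun=> 1)) ?sumr_const ?card_ord // => k _.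
  by rewrite (le_trans _ (ltW gm')) // ler_nat.
have [h|h] := leP (m.+1%:R) g.
  have -> : g = m.+1%:R by apply/le_anti; rewrite h gm.
  by rewrite -natr1 subrr normr0.
rewrite addr0 ger0_norm; first by move: gm; rewrite -natr1; lra.
by rewrite subr_ge0 ltW.
Qed.

(* Bounded measurable functions are uniform limits of simple functions. *)
Lemma bmf_linear_eq0 (L : (T -> R) -> R) (C : R) :
  (forall f g, bmf f -> bmf g -> L (fun x => f x + g x) = L f + L g) ->
  (forall c f, bmf f -> L (fun x => c * f x) = c * L f) ->
  (forall M f, bmf f -> (forall x, `|f x| <= M) -> `|L f| <= C * M) ->
  (forall A, measurable A -> L \1_A = 0) ->
  forall f, bmf f -> L f = 0.
Proof.
move=> LD LZ LC LA f hf; have [mf [M hM]] := hf.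
apply: contrapT => /eqP; rewrite -normr_gt0 => Lf.
have fM x : 0 <= f x + M <= 2 * M.
  by have := hM x; rewrite ler_norml => /andP[]; lra.
have L0 c : L (fun=> c) = 0.
  have := LZ c _ (bmf_indic R (@measurableT _ T)); rewrite LA // mulr0 => <-.
  by congr L; apply/funext => x; rewrite indicT mulr1.
have approx m : `|L f| <= C * m.+1%:R^-1.
  have m0 : 0 < m.+1%:R :> R by [].
  (* Level sets of (m+1)(f + M): the sum s of their indicators is within 1 of this function, so r =
     f + M - s/(m+1) is within 1/(m+1) of zero, while L vanishes on s and on constants and thus L r
     = L f. *)
  pose B (k : nat) := [set x | (k.+1%:R <= m.+1%:R * (f x + M))%R].
  have mB k : measurable (B k).
    rewrite -[X in measurable X]setTI; apply: measurable_fun_le => //.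
    by apply: measurable_funM => //; exact: measurable_funD.
  pose l := Num.bound (m.+1%:R * (2 * M)).
  have hl x : m.+1%:R * (f x + M) <= l%:R.
    have /andP[a b] := fM x.
    apply: (@le_trans _ _ (m.+1%:R * (2 * M))); first by rewrite ler_pM2l.
    apply/ltW/archi_boundP; rewrite mulr_ge0 //; lra.
  pose s x := \sum_(k < l) (\1_(B k) x : R).
  have bs : bmf s by apply: bmf_sum => k; exact: bmf_indic.
  have Ls : L s = 0.
    rewrite /s; elim: (l) => [|j IH].
      by under eq_fun do rewrite big_ord0; exact: L0.
    under eq_fun do rewrite big_ord_recr /=.
    rewrite LD ?IH ?LA ?addr0 //; last exact: bmf_indic.
    by apply: bmf_sum => k; exact: bmf_indic.
  pose r x := f x + (M + (- m.+1%:R^-1) * s x).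
  have br : bmf r by apply/(bmfD hf)/bmfD; [exact: bmf_cst | exact: bmfZ].
  have <- : L r = L f.
    rewrite /r LD //; last by apply: bmfD; [exact: bmf_cst | exact: bmfZ].
    rewrite LD ?L0 ?LZ ?Ls ?mulr0 ?addr0 //; [exact: bmf_cst | exact: bmfZ].
  apply: LC => // x.
  have /andP[a b] := fM x.
  have := @layer_cake_bound (m.+1%:R * (f x + M)) l _ (hl x).
  have -> : \sum_(k < l) (k.+1%:R <= m.+1%:R * (f x + M))%R%:R = s x.
    by apply: eq_bigr => k _; rewrite indicE /B mem_setE.
  move=> /(_ (mulr_ge0 (ltW m0) a)) h.
  have -> : r x = m.+1%:R^-1 * (m.+1%:R * (f x + M) - s x).
    rewrite /r; move: (lt0r_neq0 m0); set c := m.+1%:R => c0.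
    by field.
  rewrite normrM ger0_norm ?invr_ge0 //.
  by rewrite -[leRHS]mulr1 ler_wpM2l // invr_ge0.
have C0 : 0 <= C.
  by have := approx 0%N; rewrite invr1 mulr1; apply: le_trans; exact: ltW.
have := approx (Num.bound (C / `|L f|)); apply/negP; rewrite -ltNge.
rewrite ltr_pdivrMr // mulrC -ltr_pdivrMr //.
apply: lt_trans (archi_boundP _) _; first by rewrite divr_ge0 // ltW.
by rewrite ltr_nat.
Qed.

End Approximation.

(** * Independence *)

Lemma mean_comp_law (d d' : measure_display) (T : measurableType d)
    (T' : measurableType d') (R : realType) (P : probability T R)
    (mu : probability T' R) (X : {RV P >-> T'}) (f : T' -> R) :
  (forall B, measurable B -> distribution P X B = mu B) -> bmf f ->
  mean P (fun w => f (X w)) = mean mu f.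
Proof.
move=> hX hf; rewrite /mean /Rintegral; congr fine.
rewrite -[LHS](@integral_distribution _ _ _ _ _ P X (EFin \o f)).
- by apply: eq_measure_integral => B mB _; exact: hX.
- by apply/measurable_EFinP; case: hf.
- exact: (bmf_integrable P (bmf_comp (measurable_funPT X) hf)).
Qed.

Section Independence.
Context (d d' : measure_display) (T : measurableType d) (T' : measurableType d')
  (R : realType) (P : probability T R) (N : nat) (X : 'I_N -> {RV P >-> T'}).
Hypothesis indX : mutually_independent X.

Let bX (i : 'I_N) (f : T' -> R) : bmf f -> bmf (fun w => f (X i w)).
Proof. by move=> hf; apply: bmf_comp. Qed.

(* Replace the indicators of the definition by bounded measurable functions,
   one index at a time. *)
Lemma mean_prod_indep (f : 'I_N -> T' -> R) : (forall i, bmf (f i)) ->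
  mean P (fun w => \prod_i f i (X i w)) = \prod_i mean P (fun w => f i (X i w)).
Proof.
(* Functions with index below j are arbitrary, the others are indicators: j = 0 is the definition of
   independence, j = N is the claim. *)
suff H j : forall f : 'I_N -> T' -> R, (forall i, bmf (f i)) ->
    (forall i : 'I_N, (j <= i)%N -> exists2 B, measurable B & f i = \1_B) ->
    mean P (fun w => \prod_i f i (X i w)) = \prod_i mean P (fun w => f i (X i w)).
  by move=> hf; apply: (H N) => // i; rewrite leqNgt ltn_ord.
elim: j => [|j IH] {}f hf hj.
  have /choice[B hB] : forall i, exists B, measurable B /\ f i = \1_B.
    by move=> i; have [B mB ->] := hj i isT; exists B.
  have mB i : measurable (B i) by case: (hB i).
  have mXB i : measurable (X i @^-1` B i).
    by rewrite -[X in measurable X]setTI; exact: measurable_funPT.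
  have eX i : (fun w => f i (X i w)) = \1_(X i @^-1` B i).
    by apply/funext => w; rewrite (hB i).2 !indicE; congr (_%:R); apply/idP/idP; rewrite !inE.
  have := indX [set: 'I_N]%SET mB.
  rewrite (_ : \bigcap_(i in _) _ = [set w | forall i, B i (X i w)]); last first.
    by apply/seteqP; split => w /= h i => [|_]; apply: h; rewrite /= ?inE.
  set A := [set w | _] => hA.
  have mA : measurable A.
    rewrite (_ : A = \bigcap_(i in [set: 'I_N]) (X i @^-1` B i)).
      by apply: fin_bigcap_measurable.
    by apply/seteqP; split => w h i => [_|]; exact: h.
  transitivity (mean P (\1_A : T -> R)).
    congr mean; apply/funext => w; rewrite indicE.
    under eq_bigr => i _ do rewrite -[f i (X i w)]/((fun w => f i (X i w)) w) eX indicE.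
    have [h|h] := pselect (A w).
      by rewrite (mem_set h) big1 // => i _; rewrite mem_set //; exact: h.
    have [i hi] : exists i, ~ B i (X i w) by apply/existsNP.
    by rewrite (memNset h) (bigD1 i) //= memNset ?mul0r.
  rewrite mean_indic // hA.
  rewrite (_ : (\prod_(i in [set: 'I_N]%SET) P (X i @^-1` B i))%E =
     (\prod_i mean P (fun w => f i (X i w)))%:E) //.
  rewrite -prodEFin; apply: eq_big => [i|i _]; first by rewrite inE.
  by rewrite eX mean_indic // fineK // fin_num_measure.
have [Nj|jN] := leqP N j.
  by apply: IH => // i ji; move: (leq_trans (ltn_ord i) (leq_trans Nj ji)); rewrite ltnn.
pose jo := Ordinal jN.
(* With the other functions fixed, both sides of the claim are linear in the function h at index
   [jo] and agree on indicators by induction, so [bmf_linear_eq0] applies to their difference. *)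
pose up (h : T' -> R) (i : 'I_N) := if i == jo then h else f i.
have bup h : bmf h -> forall i, bmf (up h i).
  by move=> bh i; rewrite /up; case: ifP.
pose rest w := \prod_(i | i != jo) f i (X i w).
have brest : bmf rest by apply: bmf_prod => i; exact: bX.
pose c := \prod_(i | i != jo) mean P (fun w => f i (X i w)).
have E1 h : mean P (fun w => \prod_i up h i (X i w)) = mean P (fun w => h (X jo w) * rest w).
  congr mean; apply/funext => w; rewrite (bigD1 jo) //= /up eqxx; congr (_ * _).
  by apply: eq_bigr => i /negbTE ->.
have E2 h : \prod_i mean P (fun w => up h i (X i w)) = mean P (fun w => h (X jo w)) * c.
  rewrite (bigD1 jo) //= /up eqxx; congr (_ * _).
  by apply: eq_bigr => i /negbTE ->.
suff : mean P (fun w => f jo (X jo w) * rest w) - mean P (fun w => f jo (X jo w)) * c = 0.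
  move/eqP; rewrite subr_eq0 -E1 -E2 => /eqP.
  by rewrite (_ : up (f jo) = f) //; apply/funext => i; rewrite /up; case: eqP => // ->.
have [Mr hMr] := brest.2.
have Mr0 : 0 <= Mr.
  by have := normr_mean_le P brest hMr; apply: le_trans.
apply: (@bmf_linear_eq0 _ _ _ (fun h : T' -> R =>
    mean P (fun w => h (X jo w) * rest w) - mean P (fun w => h (X jo w)) * c)
    (Mr + `|c|)) => //.
- move=> g h bg bh; have b1 := bX jo bg; have b2 := bX jo bh.
  under eq_fun do rewrite mulrDl.
  rewrite !meanD //; [ring | exact: bmfM | exact: bmfM].
- move=> a h bh; have b1 := bX jo bh.
  under eq_fun do rewrite -mulrA.
  rewrite !meanZ //; [ring | exact: bmfM].
- move=> M h bh hM; have b1 := bX jo bh.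
  rewrite mulrDl (le_trans (ler_normB _ _)) // lerD //.
    apply: normr_mean_le; first exact: bmfM.
    by move=> w; rewrite normrM mulrC ler_pM.
  by rewrite normrM mulrC ler_wpM2l // normr_mean_le.
- move=> A mA; apply/eqP; rewrite subr_eq0 -E1 -E2; apply/eqP/IH.
    by apply: bup; exact: bmf_indic.
  move=> i ji; rewrite /up; case: eqP => [_|/eqP ij]; first by exists A.
  by apply: hj; rewrite ltn_neqAle ji andbT eq_sym; exact: ij.
Qed.

(* Products are built one factor at a time, which lets independence be proved by
   induction; cylM shows that this is still an algebra. *)
Inductive cyl (k : nat) : (T -> R) -> Prop :=
| cyl_cst c : cyl k (fun=> c)
| cylD F G : cyl k F -> cyl k G -> cyl k (fun w => F w + G w)
| cyl_var F f (i : 'I_N) :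
    (i < k)%N -> cyl k F -> bmf f -> cyl k (fun w => F w * f (X i w)).

Lemma cyl_bmf k F : cyl k F -> bmf F.
Proof.
elim => [c|{}F G _ bF _ bG|{}F f i _ _ bF bf]; first exact: bmf_cst.
- exact: bmfD.
- exact/bmfM/bX.
Qed.

Lemma cylM k F G : cyl k F -> cyl k G -> cyl k (fun w => F w * G w).
Proof.
move=> cF cG; elim: cG F cF => [c|{}G H _ IG _ IH|{}G f i ik _ IG bf] F cF.
- elim: cF => [b|{}F F' _ iF _ iF'|{}F f i ik _ iF bf].
  + exact: cyl_cst.
  + by under eq_fun do rewrite mulrDl; exact: cylD.
  + by under eq_fun do rewrite mulrAC; exact: cyl_var.
- under eq_fun do rewrite mulrDr.
  by apply: cylD; [exact: IG | exact: IH].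
- under eq_fun do rewrite mulrA.
  by apply: cyl_var => //; exact: IG.
Qed.

Lemma cyl_gen k f (i : 'I_N) : (i < k)%N -> bmf f -> cyl k (fun w => f (X i w)).
Proof.
move=> ik bf; under eq_fun do rewrite -[f _]mul1r.
by apply: cyl_var => //; exact: cyl_cst.
Qed.

Lemma mean_cyl_indep (k : 'I_N) F g : cyl k F -> bmf g ->
  mean P (fun w => F w * g (X k w)) = mean P F * mean P (fun w => g (X k w)).
Proof.
move=> cF bg.
(* The induction on F needs a stronger statement that carries a function h i for every index: a
   factor f (X i) of F, where i < k, is absorbed into h i, which touches only [lo]. *)
pose lo (h : 'I_N -> T' -> R) w := \prod_(i < N | (i < k)%N) h i (X i w).
pose hi (h : 'I_N -> T' -> R) w := \prod_(i < N | ~~ (i < k)%N) h i (X i w).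
have blo h : (forall i, bmf (h i)) -> bmf (lo h).
  by move=> bh; apply: bmf_prod => i; exact: bX.
have bhi h : (forall i, bmf (h i)) -> bmf (hi h).
  by move=> bh; apply: bmf_prod => i; exact: bX.
have H : forall h : 'I_N -> T' -> R, (forall i, bmf (h i)) ->
    mean P (fun w => F w * (lo h w * hi h w)) =
    mean P (fun w => F w * lo h w) *
    \prod_(i < N | ~~ (i < k)%N) mean P (fun w => h i (X i w)).
  elim: cF => [c|{}F G cF IF cG IG|{}F f i ik cF IF bf] h bh.
  - have bl := blo _ bh; have bhh := bhi _ bh.
    rewrite !meanZ //; last exact: bmfM.
    rewrite -mulrA; congr (_ * _).
    transitivity (mean P (fun w => \prod_i h i (X i w))).
      by congr mean; apply/funext => w; rewrite [RHS](bigID (fun i : 'I_N => (i < k)%N)).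
    rewrite mean_prod_indep // (bigID (fun i : 'I_N => (i < k)%N)) /=; congr (_ * _).
    (* Filling up with 1 from k on makes [lo] a product over all indices, to which [mean_prod_indep]
       applies. *)
    pose h' (i : 'I_N) := if (i < k)%N then h i else fun=> 1 : R.
    have bh' i : bmf (h' i) by rewrite /h'; case: ifP => // _; exact: bmf_cst.
    transitivity (mean P (fun w => \prod_i h' i (X i w))).
      rewrite mean_prod_indep // [RHS](bigID (fun i : 'I_N => (i < k)%N)) /=.
      rewrite [X in _ = _ * X]big1 ?mulr1 => [|i /negbTE ik].
        by apply: eq_bigr => i ik; rewrite /h' ik.
      by rewrite /h' ik mean_cst.
    congr mean; apply/funext => w.
    rewrite (bigID (fun i : 'I_N => (i < k)%N)) /=.
    rewrite [X in _ * X]big1 ?mulr1 => [|i /negbTE ik]; last by rewrite /h' ik.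
    by apply: eq_bigr => i ik; rewrite /h' ik.
  - have bF := cyl_bmf cF; have bG := cyl_bmf cG.
    have bl := blo _ bh; have bhh := bhi _ bh.
    under eq_fun do rewrite mulrDl.
    under [X in _ = mean _ X * _]eq_fun do rewrite mulrDl.
    rewrite !meanD ?IF ?IG ?mulrDl //; do ? exact: bmfM; exact/bmfM/bmfM.
  - pose h' j := if j == i then (fun x => f x * h i x) else h j.
    have bh' j : bmf (h' j) by rewrite /h'; case: ifP => // _; exact: bmfM.
    have lo' w : f (X i w) * lo h w = lo h' w.
      rewrite /lo [in LHS](bigD1 i) //= [in RHS](bigD1 i) //= /h' eqxx mulrA; congr (_ * _).
      by apply: eq_bigr => j /andP[_ /negbTE ->].
    have hi' w : hi h w = hi h' w.
      apply: eq_bigr => j jk; rewrite /h'; case: eqP => // ji.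
      by move: jk; rewrite ji ik.
    have E (w : T) : F w * f (X i w) * (lo h w * hi h w) = F w * (lo h' w * hi h' w).
      by rewrite -lo' -hi' !mulrA.
    under eq_fun do rewrite E.
    under [X in _ = mean _ X * _]eq_fun do rewrite -mulrA lo'.
    rewrite IF //; congr (_ * _); apply: eq_bigr => j jk.
    by rewrite /h'; case: eqP => // ji; move: jk; rewrite ji ik.
pose h (i : 'I_N) := if i == k then g else fun=> 1 : R.
have bh i : bmf (h i) by rewrite /h; case: ifP => // _; exact: bmf_cst.
have lo1 w : lo h w = 1.
  by rewrite /lo big1 // => i; rewrite /h; case: eqP => // ->; rewrite ltnn.
have := H h bh; rewrite (bigD1 k) /= ?ltnn // big1 ?mulr1 => [|i /andP[_ /negbTE ik]]; last first.
  by rewrite /h ik mean_cst.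
under [X in _ = mean _ X * _ -> _]eq_fun do rewrite lo1 mulr1.
rewrite /h eqxx => <-; congr mean; apply/funext => w.
rewrite -/h lo1 mul1r /hi (bigD1 k) /= ?ltnn // big1 ?mulr1 ?/h ?eqxx // => i /andP[_ /negbTE ik].
by rewrite ik.
Qed.

End Independence.

(** * Matrix Laplace transform *)

Section EntrywisePredicate.
Context (T : Type) (R : realType) (Q : (T -> R) -> Prop).
Hypotheses (Qcst : forall c, Q (fun=> c))
  (QD : forall f g, Q f -> Q g -> Q (fun x => f x + g x))
  (QM : forall f g, Q f -> Q g -> Q (fun x => f x * g x)).

(** Q ranges over three algebras: bounded measurable functions, measurable functions, and the
    functions [cyl] of the variables of index below k. Polynomial matrix expressions inherit each of
    them. *)
Definition entrywise p n (F : T -> 'M[R]_(p, n)) : Prop :=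
  forall i j, Q (fun x => F x i j).

Let Qext f g : f =1 g -> Q f -> Q g.
Proof. by move=> /funext ->. Qed.

Let Qsum (I : Type) (r : seq I) (p : pred I) (F : I -> T -> R) :
  (forall i, p i -> Q (F i)) -> Q (fun x => \sum_(i <- r | p i) F i x).
Proof.
move=> h; elim: r => [|i r IH].
  by apply: (Qext (f := fun=> 0)) => // x; rewrite big_nil.
have [pi|pi] := boolP (p i).
  by apply: Qext (QD (h i pi) IH) => x; rewrite big_cons pi.
by apply: Qext IH => x; rewrite big_cons (negbTE pi).
Qed.

Lemma entrywise_cst p n (A : 'M[R]_(p, n)) : entrywise (fun=> A).
Proof. by move=> i j. Qed.

Lemma entrywiseD p n (F G : T -> 'M[R]_(p, n)) :
  entrywise F -> entrywise G -> entrywise (fun x => F x + G x).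
Proof. by move=> hF hG i j; apply: Qext (QD (hF i j) (hG i j)) => x; rewrite mxE. Qed.

Lemma entrywiseZ p n c (F : T -> 'M[R]_(p, n)) :
  entrywise F -> entrywise (fun x => c *: F x).
Proof. by move=> hF i j; apply: Qext (QM (Qcst c) (hF i j)) => x; rewrite mxE. Qed.

Lemma entrywiseM p q n (F : T -> 'M[R]_(p, q)) (G : T -> 'M[R]_(q, n)) :
  entrywise F -> entrywise G -> entrywise (fun x => F x *m G x).
Proof.
move=> hF hG i j; apply: Qext (Qsum (index_enum _)
  (fun k (_ : predT k) => QM (hF i k) (hG k j))) => x; by rewrite mxE.
Qed.

Lemma entrywiseX n k (F : T -> 'M[R]_n) :
  entrywise F -> entrywise (fun x => F x ^+ k).
Proof.
move=> hF; elim: k => [|k IH]; first exact: entrywise_cst.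
move=> i j; apply: Qext (entrywiseM hF IH i j) => x; by rewrite exprS.
Qed.

Lemma entrywise_sum p n (I : Type) (r : seq I) (a : pred I) (F : I -> T -> 'M[R]_(p, n)) :
  (forall i, a i -> entrywise (F i)) ->
  entrywise (fun x => \sum_(i <- r | a i) F i x).
Proof.
move=> h i j; apply: Qext (Qsum r (fun k ak => h k ak i j)) => x.
by rewrite summxE.
Qed.

Lemma entrywise_pexp n k (F : T -> 'M[R]_n) :
  entrywise F -> entrywise (fun x => pexp k (F x)).
Proof.
move=> hF; apply: entrywiseX; apply: entrywiseD; first exact: entrywise_cst.
exact: entrywiseZ.
Qed.

Lemma entrywise_mxtrace n (F : T -> 'M[R]_n) :
  entrywise F -> Q (fun x => \tr (F x)).
Proof. by move=> hF; apply: Qsum => i _; exact: hF. Qed.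

Lemma entrywise_dotv n (F G : T -> 'cV[R]_n) :
  entrywise F -> entrywise G -> Q (fun x => dotv (F x) (G x)).
Proof. by move=> hF hG; apply: Qsum => i _; exact: QM. Qed.

End EntrywisePredicate.

(** Writing the trace as that of HGH turns an upper bound on the quadratic form of G into one on the
    trace. *)
Lemma mxtrace_sandwich (R : realType) n (H G : 'M[R]_n) : H^T = H ->
  \tr (H ^+ 2 * G) = \sum_i dotv (col i H) (G *m col i H).
Proof.
move=> sH; have -> : \tr (H ^+ 2 * G) = \tr (H *m (G *m H)).
  by rewrite expr2 -[H * H * G]/(H *m H *m G) -mulmxA mxtrace_mulC -mulmxA.
rewrite /mxtrace; apply: eq_bigr => i _.
rewrite /dotv mxE; apply: eq_bigr => a _.
rewrite -{1}sH !mxE; congr (_ * _); by apply: eq_bigr => b _; rewrite !mxE.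
Qed.

Section MatrixLaplaceTransform.
Context (d d' : measure_display) (T : measurableType d) (T' : measurableType d')
  (R : realType) (P : probability T R) (N : nat) (X : 'I_N -> {RV P >-> T'}).
Hypothesis indX : mutually_independent X.
Variables (n : nat) (Y : T' -> 'M[R]_n) (s : R).
Hypotheses (bY : entrywise (@bmf _ T' R) Y)
  (sY : forall x, (Y x)^T = Y x) (oY : forall x, opb (Y x) 1)
  (s0 : 0 <= s)
  (meanY : forall i v, mean P (fun w => dotv v (Y (X i w) *m v)) = 0)
  (varY : forall i v,
     mean P (fun w => dotv (Y (X i w) *m v) (Y (X i w) *m v)) <= s * dotv v v).

Let bcst := @bmf_cst _ T R.
Let bD := @bmfD _ T R.
Let bM := @bmfM _ T R.
Let bcst' := @bmf_cst _ T' R.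
Let bD' := @bmfD _ T' R.
Let bM' := @bmfM _ T' R.

Let entry_comp i p q (F : T' -> 'M[R]_(p, q)) :
  entrywise (@bmf _ T' R) F -> entrywise (@bmf _ T R) (fun w => F (X i w)).
Proof.
by move=> hF a b; exact: (@bmf_comp _ _ _ _ _ (X i) _ (measurable_funPT (X i)) (hF a b)).
Qed.

Definition partial_sum k w : 'M[R]_n := \sum_(i < N | (i < k)%N) Y (X i w).

(** H depends only on variables of index below k, so the last factor may be replaced by its mean G.
    The quadratic expansion, the vanishing mean and the variance bound give G at most 1 + 2s as a
    form, and H is carried along by the sandwich identity. *)
Let mean_pexp_step m (H : T -> 'M[R]_n) (k : 'I_N) :
  entrywise (cyl X k) H -> (forall w, (H w)^T = H w) ->
  mean P (fun w => \tr (H w ^+ 2 * pexp m (Y (X k w)))) <=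
  (1 + 2 * s) * mean P (fun w => \tr (H w ^+ 2)).
Proof.
move=> cH sH.
have cH2 : entrywise (cyl X k) (fun w => H w ^+ 2).
  by apply: entrywiseX => //; [exact: cyl_cst | exact: cylD | exact: cylM].
have bH2 i j := cyl_bmf (cH2 i j).
have bH i j := cyl_bmf (cH i j).
have bG : entrywise (@bmf _ T' R) (fun x => pexp m (Y x)) by exact: entrywise_pexp.
have bGX := entry_comp k bG.
pose G := \matrix_(i, j) mean P (fun w => pexp m (Y (X k w)) i j).
have qG v : dotv v (G *m v) <= (1 + 2 * s) * dotv v v.
  have -> : dotv v (G *m v) = mean P (fun w => dotv v (pexp m (Y (X k w)) *m v)).
    rewrite /dotv mean_sum; last first.
      by move=> i; apply: bmfZ; apply: (entrywiseM bcst bD bM bGX); exact: entrywise_cst.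
    apply: eq_bigr => i _; rewrite meanZ; last first.
      by apply: (entrywiseM bcst bD bM bGX); exact: entrywise_cst.
    congr (_ * _); rewrite mxE; under [in RHS]eq_fun do rewrite mxE.
    rewrite mean_sum => [|j]; last by apply: bmfM.
    apply: eq_bigr => j _; rewrite mxE mulrC -meanZ //.
    by congr mean; apply/funext => w; rewrite mulrC.
  have bv : entrywise (@bmf _ T R) (fun=> v) by exact: entrywise_cst.
  have bYv : entrywise (@bmf _ T R) (fun w => Y (X k w) *m v).
    by apply: (entrywiseM bcst bD bM) => //; exact: entry_comp.
  have b1 : bmf (fun w => dotv v (Y (X k w) *m v)) by exact: entrywise_dotv.
  have b2 : bmf (fun w => dotv (Y (X k w) *m v) (Y (X k w) *m v)).
    exact: entrywise_dotv.
  have b3 : bmf (fun w => dotv v v + dotv v (Y (X k w) *m v)) by exact: bmfD.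
  apply: le_trans (ler_mean P _ _ (fun w => pexp_quadratic_le m v (sY (X k w)) (oY _))) _.
  - by apply: entrywise_dotv => //; exact: entrywiseM.
  - by apply: bmfD => //; exact: bmfZ.
  - rewrite meanD ?meanD ?meanZ ?mean_cst ?meanY //; last exact: bmfZ.
    have := varY k v; lra.
have -> : mean P (fun w => \tr (H w ^+ 2 * pexp m (Y (X k w)))) =
    mean P (fun w => \tr (H w ^+ 2 * G)).
  have E (A : T -> 'M[R]_n) : entrywise (@bmf _ T R) A ->
      mean P (fun w => \tr (H w ^+ 2 * A w)) =
      \sum_i \sum_j mean P (fun w => (H w ^+ 2) i j * A w j i).
    move=> hA; rewrite /mxtrace mean_sum => [|i]; last first.
      exact: (entrywiseM bcst bD bM bH2 hA).
    apply: eq_bigr => i _; under eq_fun do rewrite mxE.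
    by rewrite mean_sum // => j; exact: bmfM.
  rewrite (E _ bGX) (E (fun=> G)); last exact: (entrywise_cst bcst).
  apply: eq_bigr => i _; apply: eq_bigr => j _.
  rewrite (mean_cyl_indep indX (cH2 i j) (bG j i)).
  rewrite mxE mulrC -meanZ //.
  by congr mean; apply/funext => w; rewrite mulrC.
rewrite -meanZ; last exact: entrywise_mxtrace.
apply: ler_mean.
- by apply: entrywise_mxtrace => //; apply: entrywiseM => //; exact: entrywise_cst.
- by apply: bmfZ; exact: entrywise_mxtrace.
- move=> w; rewrite mxtrace_sandwich //.
  rewrite (le_trans (ler_sum _ (fun i _ => qG (col i (H w))))) //.
  rewrite -mulr_sumr ler_wpM2l //; first by move: s0; lra.
  have -> : \tr (H w ^+ 2) = \tr (H w * (H w)^T) by rewrite sH expr2.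
  rewrite mxtrace_mul_tr exchange_big /=.
  rewrite le_eqVlt; apply/orP; left; apply/eqP.
  by apply: eq_bigr => i _; apply: eq_bigr => j _; rewrite !mxE expr2.
Qed.

Let sym_partial_sum k w : (partial_sum k w)^T = partial_sum k w.
Proof. by rewrite linear_sum; apply: eq_bigr => i _; exact: sY. Qed.

Let opb_partial_sum k w : opb (partial_sum k w) N%:R.
Proof.
have h : opb (partial_sum k w) (\sum_(i < N | (i < k)%N) 1).
  rewrite /partial_sum; elim/big_ind2: _ => [|A a B b hA hB|i _] //; first exact: opb0.
  exact: opbD.
apply: opbW h; rewrite -[N in leRHS]card_ord -sum1_card natr_sum.
by rewrite [leRHS](bigID (fun i : 'I_N => (i < k)%N)) /= lerDl sumr_ge0.
Qed.

Let partial_sumS (k : 'I_N) w :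
  partial_sum k.+1 w = partial_sum k w + Y (X k w).
Proof.
rewrite /partial_sum (bigD1 k) //= addrC; congr (_ + _).
by apply: eq_bigl => i; rewrite ltnS ltn_neqAle andbC.
Qed.

Let cyl_partial_sum k : entrywise (cyl X k) (partial_sum k).
Proof.
apply: entrywise_sum => [c|f g|i ik]; first exact: cyl_cst; first exact: cylD.
by move=> a b; apply: (@cyl_gen _ _ _ _ _ _ _ X k (fun x => Y x a b)).
Qed.

Let bmf_tr_pexp m k : bmf (fun w => \tr (pexp m (partial_sum k w))).
Proof.
apply: entrywise_mxtrace => //; apply: entrywise_pexp => // i j.
exact: (cyl_bmf (cyl_partial_sum k i j)).
Qed.

Lemma mean_mxtrace_pexp m :
  mean P (fun w => \tr (pexp m.+1 (partial_sum N w))) <=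
  (1 + 2 * s) ^+ N *
  (n%:R + N%:R * (n%:R * (N%:R * expR (2 * N%:R + 1)) / (2 ^ m.+1)%:R)).
Proof.
(* The Golden-Thompson error of a single step, with N as a crude operator bound for every partial
   sum; it does not depend on k. *)
set e := _ / _; have e0 : 0 <= e by rewrite !mulr_ge0 ?expR_ge0.
have q1 : 1 <= 1 + 2 * s by move: s0; lra.
suff H k : (k <= N)%N -> mean P (fun w => \tr (pexp m.+1 (partial_sum k w))) <=
    (1 + 2 * s) ^+ k * (n%:R + k%:R * e) by exact: H.
elim: k => [_|k IH kN].
  have p0 w : partial_sum 0 w = 0 by rewrite /partial_sum big_pred0.
  under eq_fun do rewrite p0 /pexp scaler0 addr0 expr1n mxtrace1.
  by rewrite mean_cst expr0 mul0r addr0 mul1r.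
pose ko := Ordinal kN.
(* Half of the power, so that [H w ^+ 2] is [pexp m.+1 (partial_sum k w)]. *)
pose H w := (1 + (2 ^ m.+1)%:R^-1 *: partial_sum k w) ^+ (2 ^ m).
have cH : entrywise (cyl X ko) H.
  have c1 := @cyl_cst _ _ _ _ _ _ _ X k; have c2 := @cylD _ _ _ _ _ _ _ X k.
  have c3 := @cylM _ _ _ _ _ _ _ X k.
  by apply: entrywiseX => //; apply: entrywiseD => //; apply: entrywiseZ.
have sH w : (H w)^T = H w by rewrite trmxX trmx_1DZ.
have step := @mean_pexp_step m.+1 H ko cH sH.
have b1 : bmf (fun w => \tr (H w ^+ 2 * pexp m.+1 (Y (X ko w)))).
  apply: entrywise_mxtrace => //; apply: entrywiseM => //.
    by apply: entrywiseX => // i j; exact: cyl_bmf (cH i j).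
  by apply: (@entry_comp ko _ _ (fun x => pexp m.+1 (Y x))); exact: entrywise_pexp.
apply: (@le_trans _ _ (mean P (fun w => \tr (H w ^+ 2 * pexp m.+1 (Y (X ko w))) + e))).
  apply: ler_mean => //; first exact: bmfD.
  move=> w; rewrite (partial_sumS ko) /=.
  have := mxtrace_pexpD m.+1 (sym_partial_sum k w) (sY (X ko w)) (ler0n _ N)
    (@opb_partial_sum k w) (oY _).
  by rewrite [pexp m.+1 (partial_sum k w)]pexp_sqr.
rewrite meanD // mean_cst.
have h := IH (ltnW kN).
have h2 : mean P (fun w => \tr (H w ^+ 2)) <= (1 + 2 * s) ^+ k * (n%:R + k%:R * e).
  by apply: le_trans h; under eq_fun do rewrite -pexp_sqr.
apply: le_trans (lerD step (lexx e)) _.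
set q := 1 + 2 * s in q1 h2 *.
have -> : q ^+ k.+1 * (n%:R + k.+1%:R * e) =
    q * (q ^+ k * (n%:R + k%:R * e)) + q ^+ k.+1 * e.
  by rewrite -natr1 exprS; ring.
apply: lerD; first by rewrite ler_wpM2l // (le_trans ler01).
by rewrite ler_peMl // exprn_ege1.
Qed.

(** The event that some direction v exceeds theta is an uncountable union, so it is only enclosed in
    a measurable set A, the event that the trace is large. *)
Lemma quadratic_form_tail (theta : R) : 0 <= theta -> exists A : set T,
  [/\ measurable A,
      fine (P A) <= 2 * n%:R * expR (2 * s * N%:R - theta / 2) &
      forall w v, v != 0 ->
        theta * dotv v v <= dotv v (partial_sum N w *m v) -> A w].
Proof.
move=> th0; set c := N%:R * (N%:R * expR (2 * N%:R + 1)) : R.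
have c0 : 0 <= c by rewrite !mulr_ge0 // expR_ge0.
(* K >= c makes the N accumulated errors at most n in total, whence the factor 2n; K >= theta gives
   theta/K <= 1, as [ler_expR_half] requires. *)
pose m := Num.bound (theta + c); set K := (2 ^ m.+1)%:R : R.
have hK : theta + c <= K.
  apply: ltW; apply: (lt_trans (archi_boundP (addr_ge0 th0 c0))).
  rewrite ltr_nat -/m; apply: (ltn_trans (ltn_expl m (ltnSn 1))).
  by rewrite ltn_exp2l.
have K0 : 0 < K by rewrite ltr0n expn_gt0.
pose b := (1 + theta / K) ^+ (2 ^ m.+1).
have hb : expR (theta / 2) <= b.
  have := @ler_expR_half R (theta / K) (2 ^ m.+1) (divr_ge0 th0 (ltW K0)).
  rewrite -/K divfK ?gt_eqF //; apply.
  by rewrite ler_pdivrMr // mul1r; move: c0 hK; lra.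
have b0 : 0 < b by apply: lt_le_trans hb; exact: expR_gt0.
exists [set w | (b <= \tr (pexp m.+1 (partial_sum N w)))%R]; split.
- rewrite -[X in measurable X]setTI; apply: measurable_fun_le => //.
  by have [] := bmf_tr_pexp m.+1 N.
- have := markov_mean P (bmf_tr_pexp m.+1 N)
    (fun w => mxtrace_pexp_ge0 m (sym_partial_sum N w)) b0.
  set p := fine _ => hp.
  have p0 : 0 <= p by exact: fine_ge0.
  have := le_trans hp (mean_mxtrace_pexp m); rewrite -/K => h.
  have h1 : N%:R * (n%:R * (N%:R * expR (2 * N%:R + 1)) / K) <= n%:R :> R.
    rewrite !mulrA ler_pdivrMr //.
    rewrite [N%:R * n%:R]mulrC -!mulrA ler_wpM2l //; rewrite -/c; move: th0 hK; lra.
  have h2 : (1 + 2 * s) ^+ N <= expR (2 * s * N%:R).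
    by apply: ler_1D_expR; move: s0; lra.
  have h3 : expR (theta / 2) * p <= expR (2 * s * N%:R) * (2 * n%:R).
    apply: le_trans (ler_wpM2r p0 hb) _; apply: le_trans h _.
    apply: ler_pM => //; first by rewrite exprn_ge0 //; move: s0; lra.
      by rewrite addr_ge0 // !mulr_ge0 ?expR_ge0 // invr_ge0 ltW.
    by move: h1; lra.
  rewrite expRD expRN mulrA ler_pdivlMr ?expR_gt0 //.
  by rewrite mulrC [leRHS]mulrC.
- move=> w v v0 hv /=.
  by rewrite /b /K; exact: mxtrace_pexp_ge hv.
Qed.

End MatrixLaplaceTransform.

(** * Spectral norm and truncated outer products *)

Section SpectralNorm.
Variables (R : realType) (n : nat).
Implicit Types (M : 'M[R]_n) (v : 'cV[R]_n).

Lemma opb_spectral_norm M : opb M (spectral_norm M).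
Proof.
have hub : has_ubound [set enorm (M *m v) | v in [set v : 'cV[R]_n | (enorm v <= 1)%R]].
  exists (Num.sqrt (\tr (M * M^T))) => _ [v /= v1 <-].
  by rewrite (le_trans (opb_frobenius M v)) // ler_piMr // sqrtr_ge0.
move=> v; have [v0|v0] := eqVneq (enorm v) 0.
  by rewrite v0 mulr0 (enorm_eq0 v0) mulmx0 enorm0.
have vp : 0 < enorm v by rewrite lt_neqAle eq_sym v0 enorm_ge0.
rewrite -ler_pdivrMr // mulrC; apply: ub_le_sup => //.
exists ((enorm v)^-1 *: v) => /=.
  by rewrite enormZ ger0_norm ?invr_ge0 ?enorm_ge0 // mulVf.
by rewrite -scalemxAr enormZ ger0_norm ?invr_ge0 ?enorm_ge0.
Qed.

Lemma spectral_norm_le M c : 0 <= c -> opb M c -> spectral_norm M <= c.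
Proof.
move=> c0 h; apply: ge_sup.
  by exists (enorm (M *m 0)); exists 0 => //=; rewrite enorm0.
by move=> _ [v /= v1 <-]; rewrite (le_trans (h v)) // ler_piMr.
Qed.

Lemma opb0_eq0 M : opb M 0 -> M = 0.
Proof.
move=> h; apply/matrixP => i j; rewrite mxE.
have := h (delta_mx j 0); rewrite mul0r => e0.
have := le_trans (entry_le_enorm _ i) e0.
rewrite normr_le0 mxE (bigD1 j) //= big1 => [|k kj].
  by rewrite mxE !eqxx mulr1 addr0 => /eqP.
by rewrite mxE (negbTE kj) mulr0.
Qed.

Lemma spectral_norm_ge0 M : 0 <= spectral_norm M.
Proof.
apply: le_trans (_ : enorm (M *m 0) <= _); first exact: enorm_ge0.
apply: ub_le_sup; last by exists 0 => //=; rewrite enorm0.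
exists (Num.sqrt (\tr (M * M^T))) => _ [v /= v1 <-].
by rewrite (le_trans (opb_frobenius M v)) // ler_piMr // sqrtr_ge0.
Qed.

Lemma rat_vector_dense v (e : R) : 0 < e ->
  exists q : 'cV[rat]_n, enorm (v - map_mx ratr q) <= e.
Proof.
move=> e0; pose h := e / n.+1%:R.
have h0 : 0 < h by rewrite divr_gt0.
have /choice[q hq] : forall i, exists q : rat, ratr q \in `]v i 0 - h, v i 0 + h[.
  by move=> i; apply: rat_in_itvoo; move: h0; lra.
exists (\col_i q i); rewrite enorm_le ?(ltW e0) //.
apply: (@le_trans _ _ (\sum_(i < n) h ^+ 2)).
  apply: ler_sum => i _; rewrite !mxE -expr2 -ler_sqrt ?exprn_ge0 ?(ltW h0) //.
  rewrite !sqrtr_sqr [`|h|]ger0_norm ?(ltW h0) //.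
  by have := hq i; rewrite in_itv /= ler_norml => /andP[a b]; apply/andP; split; lra.
rewrite sumr_const card_ord -mulr_natl.
have -> : e = n.+1%:R * h by rewrite /h mulrC divfK.
rewrite [(_ * h) ^+ 2]exprMn ler_wpM2r ?exprn_ge0 ?(ltW h0) // -natrX ler_nat.
by rewrite (leq_trans (leqnSn n)) // -mulnn leq_pmull.
Qed.

(** By continuity of both sides and density; it turns a bound on the operator norm into countably
    many conditions. *)
Lemma opb_rat M c : 0 <= c ->
  (forall q : 'cV[rat]_n, enorm (M *m map_mx ratr q) <= c * enorm (map_mx ratr q : 'cV[R]_n)) ->
  opb M c.
Proof.
move=> c0 h v; apply/ler_addgt0Pr => e e0.
set b := Num.sqrt (\tr (M * M^T)); have b0 : 0 <= b by exact: sqrtr_ge0.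
have p : 0 < b + c + 1 by lra.
have [q hq] := rat_vector_dense v (divr_gt0 e0 p).
set u := map_mx ratr q in hq; have hu := h q; rewrite -/u in hu.
have -> : M *m v = M *m u + M *m (v - u) by rewrite -mulmxDr addrC subrK.
apply: le_trans (enormD _ _) _.
have h1 := opb_frobenius M (v - u); rewrite -/b in h1.
have h2 : enorm u <= enorm v + enorm (v - u).
  rewrite -[X in enorm X <= _](subrK v) addrC (le_trans (enormD _ _)) //.
  by rewrite -opprB -scaleN1r enormZ normrN1 mul1r.
have h3 : enorm (v - u) * (b + c + 1) <= e by rewrite -ler_pdivlMr.
have h4 : c * enorm u <= c * (enorm v + enorm (v - u)) by rewrite ler_wpM2l.
have := enorm_ge0 (v - u).
rewrite mulrDr in h4; nra.
Qed.

Lemma measurable_spectral_norm_le (d : measure_display) (T : measurableType d)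
    (F : T -> 'M[R]_n) (c : R) :
  entrywise (@measurable_fun _ _ T R setT) F -> 0 <= c ->
  measurable [set w | (spectral_norm (F w) <= c)%R].
Proof.
move=> mF c0.
(* An enumeration of the rational vectors; an index that codes none gives the zero vector, which
   adds no constraint. *)
pose r (k : nat) : 'cV[R]_n := map_mx ratr (odflt 0 (unpickle k : option 'cV[rat]_n)).
rewrite (_ : [set w | _] = \bigcap_k [set w | (enorm (F w *m r k) <= c * enorm (r k))%R]).
  apply: bigcapT_measurable => k.
  rewrite (_ : [set w | _] =
      [set w | (dotv (F w *m r k) (F w *m r k) <= (c * enorm (r k)) ^+ 2)%R]).
    rewrite -[X in measurable X]setTI; apply: measurable_fun_le => //.
    have mc := fun a : R => @measurable_cst _ _ T R setT a.
    have mD := fun f g : T -> R => @measurable_funD _ T R setT f g.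
    have mM := fun f g : T -> R => @measurable_funM _ T R setT f g.
    have mFr : entrywise (@measurable_fun _ _ T R setT) (fun w => F w *m r k).
      by apply: entrywiseM => //; exact: entrywise_cst.
    exact: entrywise_dotv.
  by apply/seteqP; split => w /=; rewrite enorm_le ?mulr_ge0 ?enorm_ge0.
apply/seteqP; split => w /= h => [k _ /=|].
  by rewrite (le_trans (opb_spectral_norm _ _)) // ler_wpM2r // enorm_ge0.
apply: spectral_norm_le => //; apply: opb_rat => // q.
by have := h (pickle q) I; rewrite /r pickleK.
Qed.

End SpectralNorm.

Section TruncatedOuterProduct.
Variables (R : realType) (n : nat) (mu : probability (n.-tuple R) R) (m : R).
Hypothesis m0 : 0 <= m.
Implicit Types (x : n.-tuple R) (u v : 'cV[R]_n).

Definition origin_ball : set (n.-tuple R) :=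
  [set x | (enorm (colv x) <= Num.sqrt m)%R].

(** The indicator makes the entries bounded everywhere and not just almost surely, as [bmf]
    demands. *)
Definition outer_product x : 'M[R]_n :=
  \1_origin_ball x *: (colv x *m (colv x)^T).

Let mD := fun f g => @measurable_funD _ (n.-tuple R) R setT f g.
Let mM := fun f g => @measurable_funM _ (n.-tuple R) R setT f g.

Lemma measurable_colv : entrywise (@measurable_fun _ _ (n.-tuple R) R setT) (@colv R n).
Proof. by move=> i j; under eq_fun do rewrite mxE; exact: measurable_tnth. Qed.

Lemma origin_ballE x : origin_ball x = (dotv (colv x) (colv x) <= m)%R.
Proof. by rewrite /origin_ball /= enorm_le ?sqrtr_ge0 // sqr_sqrtr. Qed.

Lemma measurable_origin_ball : measurable origin_ball.
Proof.
rewrite (_ : origin_ball = [set x | (dotv (colv x) (colv x) <= m)%R]).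
  rewrite -[X in measurable X]setTI; apply: measurable_fun_le => //.
  by apply: entrywise_dotv => //; exact: measurable_colv.
by apply/seteqP; split => x; rewrite origin_ballE.
Qed.

Lemma outer_product_entryE x i j :
  outer_product x i j = \1_origin_ball x * (colv x *m (colv x)^T) i j.
Proof. by rewrite mxE. Qed.

Lemma outer_product_ball x : origin_ball x -> outer_product x = colv x *m (colv x)^T.
Proof. by move=> h; rewrite /outer_product indicE mem_set // scale1r. Qed.

Lemma outer_product_mulmx x v :
  outer_product x *m v = (\1_origin_ball x * dotv (colv x) v) *: colv x.
Proof.
rewrite /outer_product -scalemxAl -scalerA; congr (_ *: _).
rewrite -mulmxA; apply/matrixP => i j.
by rewrite ord1 mxE big_ord1 -dotvE mulrC [in RHS]mxE.
Qed.

Lemma outer_product_sym x : (outer_product x)^T = outer_product x.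
Proof. by rewrite /outer_product linearZ /= trmx_mul trmxK. Qed.

Lemma measurable_outer i j :
  measurable_fun setT (fun x => (colv x *m (colv x)^T) i j : R).
Proof.
apply: (entrywiseM (Q := @measurable_fun _ _ (n.-tuple R) R setT)) => //.
  exact: measurable_colv.
by move=> a b; under eq_fun do rewrite mxE; exact: measurable_colv.
Qed.

Lemma bmf_outer_product : entrywise (@bmf _ (n.-tuple R) R) outer_product.
Proof.
move=> i j; under eq_fun do rewrite outer_product_entryE; split.
  by apply: mM; [apply: measurable_indic; exact: measurable_origin_ball | exact: measurable_outer].
exists m => x; rewrite indicE; have [h|h] := pselect (origin_ball x); last first.
  by rewrite memNset // mul0r normr0.
rewrite mem_set // mul1r mxE big_ord1 !mxE.
have hi k : `|tnth x k| <= enorm (colv x).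
  by apply: le_trans (entry_le_enorm (colv x) k); rewrite mxE.
rewrite normrM; apply: le_trans (ler_pM _ _ (hi i) (hi j)) _ => //.
by rewrite -expr2 enorm_sqr -origin_ballE.
Qed.

Lemma quadratic_outer_product x v : dotv v (outer_product x *m v) =
  \1_origin_ball x * dotv (colv x) v ^+ 2.
Proof. by rewrite outer_product_mulmx dotvZr (dotvC v) -mulrA expr2. Qed.

Lemma quadratic_outer_product_ge0 x v : 0 <= dotv v (outer_product x *m v).
Proof. by rewrite quadratic_outer_product mulr_ge0 ?sqr_ge0 // indicE. Qed.

Lemma quadratic_outer_product_le x v :
  dotv v (outer_product x *m v) <= m * dotv v v.
Proof.
rewrite quadratic_outer_product indicE; have [h|h] := pselect (origin_ball x).
  rewrite mem_set // mul1r (le_trans (dotv_CauchySchwarz _ _)) //.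
  by rewrite ler_wpM2r ?dotv_ge0 // -origin_ballE.
by rewrite memNset // mul0r mulr_ge0 // dotv_ge0.
Qed.

(** (xx^T)^2 = |x|^2 xx^T, and |x|^2 is at most m on the ball. *)
Lemma outer_product_sqr_le x v :
  dotv (outer_product x *m v) (outer_product x *m v) <=
  m * dotv v (outer_product x *m v).
Proof.
rewrite quadratic_outer_product outer_product_mulmx dotvZl dotvZr indicE.
have [h|h] := pselect (origin_ball x).
  rewrite mem_set // !mul1r mulrA -expr2 mulrC ler_wpM2r ?sqr_ge0 //.
  by rewrite -origin_ballE.
by rewrite memNset // !mul0r mulr0.
Qed.

Hypothesis supp : supported_in mu origin_ball.

Lemma covmx_outer_product :
  covmx mu = \matrix_(i, j) mean mu (fun x => outer_product x i j).
Proof.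
apply/matrixP => i j; rewrite !mxE /mean /Rintegral unlock; congr fine.
have mB := measurable_origin_ball.
apply: ae_eq_integral => //.
- by apply/measurable_EFinP; exact: measurable_outer.
- by apply/measurable_EFinP; case: (bmf_outer_product i j).
- exists (~` origin_ball); split; first exact: measurableC.
    by have := probability_setC mu mB; rewrite (supp : mu _ = _) subee.
  move=> x /=; apply: contra_not => h _.
  by rewrite outer_product_ball.
Qed.

Lemma covmx_sym : (covmx mu)^T = covmx mu.
Proof.
rewrite covmx_outer_product; apply/matrixP => i j; rewrite !mxE.
by congr mean; apply/funext => x; rewrite -[in LHS]outer_product_sym mxE.
Qed.

Let bcst := @bmf_cst _ (n.-tuple R) R.
Let bD := @bmfD _ (n.-tuple R) R.
Let bM := @bmfM _ (n.-tuple R) R.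

Let bmf_outer_product_mul v :
  entrywise (@bmf _ (n.-tuple R) R) (fun x => outer_product x *m v).
Proof. by apply: entrywiseM => //; exact: bmf_outer_product. Qed.

Let bmf_dotv_outer_product u v : bmf (fun x => dotv u (outer_product x *m v)).
Proof. by apply: entrywise_dotv => //; exact: entrywise_cst. Qed.

Lemma mean_dotv_outer_product u v :
  mean mu (fun x => dotv u (outer_product x *m v)) = dotv u (covmx mu *m v).
Proof.
rewrite covmx_outer_product /dotv mean_sum => [|i]; last exact: bmfZ (bmf_outer_product_mul v i 0).
apply: eq_bigr => i _; rewrite meanZ; last exact: bmf_outer_product_mul.
congr (_ * _).
rewrite mxE; under eq_fun do rewrite mxE.
rewrite mean_sum => [|j]; last exact: bmfM (bmf_outer_product i j) (bcst _).
apply: eq_bigr => j _; rewrite mxE mulrC -meanZ; last exact: bmf_outer_product.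
by congr mean; apply/funext => x; rewrite mulrC.
Qed.

Lemma quadratic_covmx_ge0 v : 0 <= dotv v (covmx mu *m v).
Proof.
rewrite -mean_dotv_outer_product -[leLHS](mean_cst mu).
by apply: ler_mean => // x; exact: quadratic_outer_product_ge0.
Qed.

Lemma quadratic_covmx_le v : dotv v (covmx mu *m v) <= m * dotv v v.
Proof.
rewrite -mean_dotv_outer_product -[leRHS](mean_cst mu).
by apply: ler_mean => // x; exact: quadratic_outer_product_le.
Qed.

Lemma quadratic_covmx_le_spectral v :
  dotv v (covmx mu *m v) <= spectral_norm (covmx mu) * dotv v v.
Proof.
rewrite (le_trans (ler_norm _)) // (le_trans (dotv_le_enorm _ _)) //.
rewrite -enorm_sqr expr2 mulrCA ler_wpM2l ?enorm_ge0 //.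
exact: opb_spectral_norm.
Qed.

Definition centered_outer_product (lam : R) x : 'M[R]_n :=
  lam *: (outer_product x - covmx mu).

Lemma bmf_centered_outer_product lam :
  entrywise (@bmf _ (n.-tuple R) R) (centered_outer_product lam).
Proof.
apply: entrywiseZ => //; apply: (entrywiseD bD); first exact: bmf_outer_product.
exact: entrywise_cst.
Qed.

Lemma centered_outer_product_sym lam x :
  (centered_outer_product lam x)^T = centered_outer_product lam x.
Proof. by rewrite linearZ /= linearB /= outer_product_sym covmx_sym. Qed.

(** The forms of the outer product and of the covariance both lie between 0 and m |v|^2, so their
    difference costs m and not 2m. *)
Lemma opb_centered_outer_product lam x : `|lam| * m <= 1 ->
  opb (centered_outer_product lam x) 1.
Proof.
move=> lm; apply: opb_polarization => // [|v]; first exact: centered_outer_product_sym.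
rewrite -scalemxAl dotvZr mulmxBl dotvDr dotvNr normrM mul1r.
have a1 := quadratic_outer_product_ge0 x v.
have a2 := quadratic_outer_product_le x v.
have b1 := quadratic_covmx_ge0 v.
have b2 := quadratic_covmx_le v.
apply: (@le_trans _ _ (`|lam| * (m * dotv v v))).
  by rewrite ler_wpM2l // ler_norml; apply/andP; split; lra.
by rewrite mulrA -[leRHS]mul1r ler_wpM2r ?dotv_ge0.
Qed.

Lemma mean_centered_outer_product lam v :
  mean mu (fun x => dotv v (centered_outer_product lam x *m v)) = 0.
Proof.
have E x : dotv v (centered_outer_product lam x *m v) =
    lam * (dotv v (outer_product x *m v) + - dotv v (covmx mu *m v)).
  by rewrite -scalemxAl dotvZr mulmxBl dotvDr dotvNr.
under eq_fun do rewrite E.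
rewrite meanZ ?meanD ?mean_cst // ?mean_dotv_outer_product ?subrr ?mulr0 //.
exact: bmfD.
Qed.

Lemma variance_centered_outer_product lam v :
  mean mu (fun x => dotv (centered_outer_product lam x *m v)
                         (centered_outer_product lam x *m v)) <=
  (lam ^+ 2 * m * spectral_norm (covmx mu)) * dotv v v.
Proof.
set u := covmx mu *m v.
apply: (@le_trans _ _ (mean mu (fun x => lam ^+ 2 *
    (m * dotv v (outer_product x *m v) + ((- 2) * dotv u (outer_product x *m v) + dotv u u))))).
  have b1 : entrywise (@bmf _ (n.-tuple R) R) (fun x => centered_outer_product lam x *m v).
    apply: entrywiseM => //; exact: bmf_centered_outer_product.
  apply: ler_mean.
  - exact: entrywise_dotv.
  - by apply/bmfZ/bmfD; [exact: bmfZ | apply: bmfD => //; exact: bmfZ].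
  move=> x; rewrite -scalemxAl dotvZr dotvZl mulrA -expr2 ler_wpM2l ?sqr_ge0 //.
  rewrite mulmxBl -/u !(dotvDl, dotvDr, dotvNl, dotvNr) (dotvC _ u).
  have := outer_product_sqr_le x v; lra.
have b2 : bmf (fun x => - 2 * dotv u (outer_product x *m v) + dotv u u).
  by apply: bmfD => //; exact: bmfZ.
rewrite meanZ; last by apply: bmfD => //; exact: bmfZ.
rewrite meanD // ?meanZ // ?meanD // ?meanZ //; do ?exact: bmfZ.
rewrite mean_cst !mean_dotv_outer_product -/u.
rewrite -[leRHS]mulrA -[leRHS]mulrA ler_wpM2l ?sqr_ge0 //.
have := quadratic_covmx_le_spectral v; rewrite -/u => h.
have : m * dotv v u <= m * (spectral_norm (covmx mu) * dotv v v) by rewrite ler_wpM2l.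
have := dotv_ge0 u; lra.
Qed.

End TruncatedOuterProduct.

(** * Sample covariance *)

Section SampleCovariance.
Variables (R : realType) (n : nat) (mu : probability (n.-tuple R) R) (m : R)
  (d : measure_display) (T : measurableType d) (P : probability T R)
  (N : nat) (X : 'I_N -> {RV P >-> n.-tuple R}).
Hypotheses (m0 : 0 <= m) (supp : supported_in mu (origin_ball m))
  (iidX : iid_sample mu X).

Lemma centered_outer_product_tail (lam theta : R) :
  `|lam| * m <= 1 -> 0 <= theta -> exists A : set T,
  [/\ measurable A,
      fine (P A) <= 2 * n%:R *
        expR (2 * (lam ^+ 2 * m * spectral_norm (covmx mu)) * N%:R - theta / 2) &
      forall w v, v != 0 -> theta * dotv v v <=
        dotv v (partial_sum X (centered_outer_product mu m lam) N w *m v) -> A w].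
Proof.
move=> lm th0; have [indX lawX] := iidX.
have bcst := @bmf_cst _ (n.-tuple R) R.
have bY : entrywise (@bmf _ (n.-tuple R) R) (centered_outer_product mu m lam).
  exact: bmf_centered_outer_product.
have bYv v : entrywise (@bmf _ (n.-tuple R) R)
    (fun x => centered_outer_product mu m lam x *m v).
  apply: (entrywiseM bcst (@bmfD _ _ R) (@bmfM _ _ R) bY).
  exact: (entrywise_cst bcst).
have bdot := @entrywise_dotv _ R (@bmf _ (n.-tuple R) R) bcst (@bmfD _ _ R) (@bmfM _ _ R).
apply: (quadratic_form_tail indX bY) => //.
- by move=> x; apply: centered_outer_product_sym.
- by move=> x; apply: opb_centered_outer_product.
- exact: mulr_ge0 (mulr_ge0 (sqr_ge0 lam) m0) (spectral_norm_ge0 _).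
- move=> i v.
  rewrite (mean_comp_law (f := fun x => dotv v (centered_outer_product mu m lam x *m v)) (lawX i)).
    exact: mean_centered_outer_product.
  by apply: bdot => //; exact: (entrywise_cst bcst).
- move=> i v.
  rewrite (mean_comp_law (f := fun x => dotv (centered_outer_product mu m lam x *m v)
     (centered_outer_product mu m lam x *m v)) (lawX i)).
    exact: variance_centered_outer_product.
  exact: bdot.
Qed.

Lemma partial_sum_centered_outer_product lam w : (0 < N)%N ->
  (forall i, origin_ball m (X i w)) ->
  partial_sum X (centered_outer_product mu m lam) N w =
  (lam * N%:R) *: (sample_covmx (fun i => X i w) - covmx mu).
Proof.
move=> N0 hX; rewrite /partial_sum /sample_covmx.
under eq_bigl do rewrite ltn_ord.
rewrite /centered_outer_product -scaler_sumr -scalerA; congr (_ *: _).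
rewrite sumrB sumr_const card_ord scalerBr scalerA mulfV ?pnatr_eq0 -?lt0n //.
rewrite scale1r scaler_nat; congr (_ - _).
by apply: eq_bigr => i _; rewrite outer_product_ball.
Qed.

Lemma measurable_sample_covmx : entrywise (@measurable_fun _ _ T R setT)
  (fun w => sample_covmx (fun i => X i w) - covmx mu).
Proof.
have mc := fun a : R => @measurable_cst _ _ T R setT a.
have mD := fun f g : T -> R => @measurable_funD _ T R setT f g.
have mM := fun f g : T -> R => @measurable_funM _ T R setT f g.
apply: entrywiseD => //; apply: entrywiseZ => //; apply: entrywise_sum => // i _.
have mX : entrywise (@measurable_fun _ _ T R setT) (fun w => colv (X i w)).
  move=> a b; exact: (measurableT_comp (@measurable_colv R n a b)).
apply: entrywiseM => // a b.
by under eq_fun do rewrite mxE; exact: mX.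
Qed.

Lemma all_in_ball : measurable [set w | forall i, origin_ball m (X i w)] /\
  P [set w | forall i, origin_ball m (X i w)] = 1%E.
Proof.
have [indX lawX] := iidX.
have mB := @measurable_origin_ball R n m m0.
have mXB i : measurable (X i @^-1` origin_ball m).
  by rewrite -[X in measurable X]setTI; exact: measurable_funPT.
have E : [set w | forall i, origin_ball m (X i w)] =
    \bigcap_(i in [set` [set: 'I_N]%SET]) (X i @^-1` origin_ball m).
  by apply/seteqP; split => w /= h i => [_|]; apply: h; rewrite /= ?inE.
split; first by rewrite E; apply: fin_bigcap_measurable.
rewrite E (indX [set: 'I_N]%SET (fun=> origin_ball m) (fun=> mB)).
by rewrite big1 // => i _; exact: etrans (lawX i _ mB) supp.
Qed.

Lemma sample_covmx_deviation (eps : R) : (0 < N)%N -> 0 < m -> 0 < eps < 1 ->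
  fine (P (~` [set w | (spectral_norm (sample_covmx (fun i => X i w) - covmx mu)
                 <= eps * spectral_norm (covmx mu))%R])) <=
  4 * n%:R * expR (- (eps ^+ 2 * spectral_norm (covmx mu) * N%:R / (32 * m))).
Proof.
move=> N0 mp /andP[e0 e1].
set L := spectral_norm _; have L0 : 0 <= L := spectral_norm_ge0 _.
set G := [set w | _].
have mG : measurable G.
  apply: measurable_spectral_norm_le; first exact: measurable_sample_covmx.
  by rewrite mulr_ge0 // ltW.
have NN : 0 < N%:R :> R by rewrite ltr0n.
(* The minimizer of the exponent 2 lam^2 m L N - lam N eps L / 2, whose minimum is -eps^2 L N / (32
   m). *)
pose lam := eps / (8 * m).
have lamp : 0 < lam by rewrite divr_gt0 // mulr_gt0.
pose theta := lam * N%:R * (eps * L).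
have th0 : 0 <= theta := mulr_ge0 (mulr_ge0 (ltW lamp) (ler0n R N)) (mulr_ge0 (ltW e0) L0).
have lm : `|lam| * m <= 1.
  rewrite gtr0_norm // (_ : lam * m = eps / 8); first by lra.
  by rewrite /lam; field; exact: lt0r_neq0.
have lm' : `|- lam| * m <= 1 by rewrite normrN.
have [A1 [mA1 hA1 A1P]] := centered_outer_product_tail lm th0.
have [A2 [mA2 hA2 A2P]] := centered_outer_product_tail lm' th0.
have [mE PE] := all_in_ball.
set E := [set w | forall i, _] in mE PE.
(* On E the truncation is invisible and the partial sum is a multiple of the deviation. Outside A1
   and A2 its form is bounded on both sides, and polarization gives the norm. The tail sets concern
   nonzero v only, hence the separate case v = 0. *)
have sub : ~` G `<=` ~` E `|` (A1 `|` A2).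
  move=> w; apply: contra_notP => /not_orP[/contrapT hE /not_orP[h1 h2]].
  apply: spectral_norm_le; first by rewrite mulr_ge0 // ltW.
  apply: opb_polarization; first by rewrite mulr_ge0 // ltW.
    rewrite linearB /= (covmx_sym m0 supp) linearZ /= linear_sum /=; congr (_ *: _ - _).
    by apply: eq_bigr => i _; rewrite trmx_mul trmxK.
  move=> v; have [->|v0] := eqVneq v 0.
    by rewrite mulmx0 -(scale0r 0) !dotvZr !mul0r mulr0 normr0.
  have lN : 0 < lam * N%:R by rewrite mulr_gt0.
  rewrite leNgt ltr_normr; apply/negP => /orP[] hv.
  - apply: h1; apply: (A1P w v v0).
    rewrite partial_sum_centered_outer_product // -scalemxAl dotvZr.
    by rewrite /theta -[leLHS]mulrA ler_pM2l // ltW.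
  - apply: h2; apply: (A2P w v v0).
    rewrite partial_sum_centered_outer_product // -scalemxAl dotvZr.
    by rewrite /theta !mulNr -mulrN -[leLHS]mulrA ler_pM2l // ltW.
have PnE : P (~` E) = 0%E by rewrite probability_setC // PE subee.
have fA A : measurable A -> P A \is a fin_num by move=> ?; exact: fin_num_measure.
have mA12 : measurable (A1 `|` A2) by exact: measurableU.
have mnE : measurable (~` E) by exact: measurableC.
have mnG : measurable (~` G) by exact: measurableC.
apply: (@le_trans _ _ (fine (P A1) + fine (P A2))).
  rewrite -lee_fin EFinD !fineK ?fA //.
  apply: (le_trans (le_measure P _ _ sub)); rewrite ?inE //; first exact: measurableU.
  apply: (le_trans (measureU2 _ _ _)) => //.
  by rewrite [X in (X + _)%E]PnE add0e; exact: measureU2.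
apply: le_trans (lerD hA1 hA2) _.
rewrite sqrrN -/L.
have -> : 2 * (lam ^+ 2 * m * L) * N%:R - theta / 2 =
    - (eps ^+ 2 * L * N%:R / (32 * m)).
  by rewrite /theta /lam; field; exact: lt0r_neq0.
by rewrite le_eqVlt; apply/orP; left; apply/eqP; ring.
Qed.

End SampleCovariance.

Theorem corollary5p52 (R : realType) :
  exists C : R, 0 < C /\
  forall (n : nat) (mu : probability (n.-tuple R) R) (m : R)
    (d : measure_display) (T : measurableType d) (P : probability T R)
    (N : nat) (X : 'I_N -> {RV P >-> n.-tuple R}) (eps t : R),
    centered mu ->
    covmx mu != 0 ->
    0 <= m ->
    supported_in mu [set x | enorm (colv x) <= Num.sqrt m] ->
    (1 <= N)%N ->
    iid_sample mu X ->
    0 < eps < 1 ->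
    1 <= t ->
    C * (t / eps) ^+ 2 * (spectral_norm (covmx mu))^-1 * m * ln n%:R <= N%:R ->
    ((1 - n%:R `^ (- t ^+ 2))%:E <=
     P [set w | (spectral_norm (sample_covmx (fun i => X i w) - covmx mu)
                 <= eps * spectral_norm (covmx mu))%R])%E.
Proof.
(* 128 = 4 * 32: the sample size makes the exponential factor at most n^(-4 t^2), and since t >= 1
   the surplus n^(-3 t^2) absorbs the prefactor 4n, which is at most n^3. *)
exists 128; split=> // n mu m d T P N X eps t _ cov0 m0 supp N1 iidX heps t1 hN.
have supp' : supported_in mu (origin_ball m) by [].
have L0 : 0 < spectral_norm (covmx mu).
  rewrite lt_neqAle spectral_norm_ge0 andbT eq_sym; apply: contra_neq cov0 => h.
  by apply: opb0_eq0; rewrite -h; exact: opb_spectral_norm.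
(* With m = 0 the form of the covariance would vanish, and so would the matrix. *)
have mp : 0 < m.
  rewrite lt_neqAle m0 andbT eq_sym; apply: contra_neq cov0 => h.
  apply/opb0_eq0/opb_polarization => // [|v]; first exact: covmx_sym supp'.
  rewrite ger0_norm ?(quadratic_covmx_ge0 m0 supp') //.
  by rewrite -h; exact: quadratic_covmx_le.
set L := spectral_norm _ in L0 hN *.
set G := [set w | _].
have [n0|n0] := posnP n.
  case/eqP: cov0; apply/matrixP => i; by have := ltn_ord i; rewrite {2}n0.
(* For n = 1 the claimed probability is 1 - 1 = 0; this case is set apart because 4n <= n^3 needs n
   >= 2. *)
have [n1|n1] := leqP n 1.
  have -> : n = 1%N by apply/eqP; rewrite eqn_leq n1.
  by rewrite powR1 subrr measure_ge0.
have mG : measurable G.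
  apply: measurable_spectral_norm_le; first exact: measurable_sample_covmx.
  by rewrite mulr_ge0 ?ltW //; case/andP: heps.
have fG : P G \is a fin_num by exact: fin_num_measure.
have := sample_covmx_deviation m0 supp' iidX N1 mp heps.
rewrite -/L -/G probability_setC // fineB //.
rewrite -(fineK fG) lee_fin /=; set p := fine _.
have nR : 2 <= n%:R :> R by rewrite ler_nat.
have nR0 : 0 < n%:R :> R by lra.
set e := expR _ => he.
suff : 4 * n%:R * e <= n%:R `^ (- t ^+ 2) by move: he; lra.
have [e0 e1] := andP heps.
set l := ln n%:R in hN *.
have l0 : 0 <= l by rewrite ln_ge0 //; lra.
have en : expR l = n%:R by rewrite lnK // posrE.
have -> : n%:R `^ (- t ^+ 2) = expR (- t ^+ 2 * l) by rewrite /powR gt_eqF.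
have h1 : 4 * n%:R <= expR (3 * l) :> R.
  rewrite expRM_natl en; set x := n%:R in nR nR0 *; rewrite !exprS expr0; nra.
have h2 : e <= expR (- (4 * t ^+ 2 * l)).
  rewrite /e ler_expR lerN2.
  have -> : eps ^+ 2 * L * N%:R / (32 * m) = N%:R * (eps ^+ 2 * L / (32 * m)).
    by field; exact: lt0r_neq0.
  have c0 : 0 < eps ^+ 2 * L / (32 * m).
    by rewrite divr_gt0 ?mulr_gt0 ?exprn_gt0.
  apply: le_trans (ler_wpM2r (ltW c0) hN).
  rewrite le_eqVlt; apply/orP; left; apply/eqP.
  field; rewrite !lt0r_neq0 //.
apply: (@le_trans _ _ (expR (3 * l) * expR (- (4 * t ^+ 2 * l)))).
  by apply: ler_pM => //; rewrite ?expR_ge0 // mulr_ge0 // ltW.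
rewrite -expRD ler_expR.
have : l <= t ^+ 2 * l by rewrite ler_peMl // exprn_ege1.
lra.
Qed.
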